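(* $\Xi_+\subseteq\Xi_{\rm nr}$; that is, for every $\xi\in\Xi_+=G\exp(i\Omega_H)\cdot\xi_o$ the horosphere $E(\xi)\subset X_{\mathbb C}$ satisfies $E(\xi)\cap Y=\emptyset$.
   Context: $\mathfrak g$ is a simple non-compact real Lie algebra with Cartan involution $\theta$, $\mathfrak g=\mathfrak k+\mathfrak p$, $\mathfrak a\subset\mathfrak p$ maximal abelian, $\Sigma=\Sigma(\mathfrak g,\mathfrak a)$ the restricted roots, $\Pi=\{\alpha_1,\dots,\alpha_n\}$ a basis, $\Sigma^+$ the positive roots, $\mathcal W$ the Weyl group. Fix $\alpha\in\Pi$ whose coefficient in the highest root is $1$ (assumed to exist), and $Z\in\mathfrak a$ with $\alpha_i(Z)=1$ if $\alpha_i=\alpha$, $0$ otherwise; $\operatorname{ad}Z$ gives a grading $\mathfrak g=\mathfrak g_{-1}+\mathfrak g_0+\mathfrak g_1$. Let $\sigma=(-1)^j$ on $\mathfrak g_j$, $\tau=\sigma\circ\theta$. Put $Z_H=\frac\pi2Z$, $z_H=\exp(iZ_H)$, $\Omega_H=$ interior of the convex hull of $\mathcal W(Z_H)$. $G$ is a linear connected Lie group with Lie algebra $\mathfrak g$ and $G_{\mathbb C}$ its linear connected complexification; $\tau$ and its complex linear extension are assumed to exponentiate to $G$, $G_{\mathbb C}$, with fixed point groups $H,H_{\mathbb C}$. $K=G^\theta$, with complexification $K_{\mathbb C}\subset G_{\mathbb C}$. $Y=G/H$ is a non-compactly causal (NCC) symmetric space. $X_{\mathbb C}=G_{\mathbb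 C}/K_{\mathbb C}$ with base point $x_o$. One has $z_HK_{\mathbb C}z_H^{-1}=H_{\mathbb C}$, and $Y$ is identified with the orbit $G\cdot y_o\subset X_{\mathbb C}$, $y_o=z_H\cdot x_o$. $A=\exp\mathfrak a$, $N=\exp(\sum_{\alpha\in\Sigma^+}\mathfrak g^\alpha)$, $G=NAK$, with complexifications $A_{\mathbb C},N_{\mathbb C}$; $M_{\mathbb C}=Z_{K_{\mathbb C}}(A)$. $\Xi=G_{\mathbb C}/M_{\mathbb C}N_{\mathbb C}$ with base point $\xi_o$; for $\xi=g\cdot\xi_o\in\Xi$ the associated horosphere is $E(\xi)=gN_{\mathbb C}\cdot x_o\subset X_{\mathbb C}$. $\Xi_{\rm nr}=\{\xi\in\Xi: E(\xi)\cap Y=\emptyset\}$ (horospheres without real points). *)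

(* Defs.v *)
From HB Require Import structures.
From mathcomp Require Import all_boot all_order all_algebra.
From mathcomp Require Import complex.
From mathcomp Require Import all_classical all_reals all_analysis.
Set Implicit Arguments.
Unset Strict Implicit.
Unset Printing Implicit Defensive.
Import Order.TTheory GRing.Theory Num.Theory.
Import numFieldNormedType.Exports.
Local Open Scope classical_set_scope.
Local Open Scope ring_scope.

(* The complex numbers, seen as a [numClosedFieldType]: the topology of
   matrices over them is only inferred through this structure. *)
Definition Cx (R : realType) : numClosedFieldType := (R[i])%C.

Definition realC (R : realType) (x : R) : Cx R := (x%:C)%C.

Definition imC (R : realType) : Cx R := ('i)%C.

Record lieAlgebra (R : realType) := LieAlgebra {
  lie_sort :> vectType R;
  lie : lie_sort -> lie_sort -> lie_sort;
  lie_linearl : forall (c : R) X Y W,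
    lie (c *: X + Y) W = c *: lie X W + lie Y W;
  lie_linearr : forall (c : R) X Y W,
    lie W (c *: X + Y) = c *: lie W X + lie W Y;
  lie_alt : forall X, lie X X = 0;
  lie_jacobi : forall X Y W,
    lie X (lie Y W) + lie Y (lie W X) + lie W (lie X Y) = 0
}.
Arguments lie {R l} X Y.

Section Algebra.
Context {R : realType} {g : lieAlgebra R}.

(* [g] is finite dimensional; [f] is meant to be linear. *)
Definition trace (f : g -> g) : R :=
  \sum_i coord (vbasis {:g}) i (f (vbasis {:g})`_i).

Definition killing (X Y : g) : R := trace (fun W => lie X (lie Y W)).

Definition simple_lie : Prop :=
  (exists X Y : g, lie X Y != 0) /\
  (forall I : {vspace g}, (forall X Y, Y \in I -> lie X Y \in I) ->
     I = 0%VS \/ I = fullv).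

(* A simple real Lie algebra is compact iff its Killing form is negative
   definite. *)
Definition noncompact_lie : Prop :=
  ~ (forall X : g, X != 0 -> killing X X < 0).

Definition cartan_involution (theta : 'End(g)) : Prop :=
  [/\ forall X, theta (theta X) = X,
      forall X Y, theta (lie X Y) = lie (theta X) (theta Y)
    & forall X, X != 0 -> 0 < - killing X (theta X)].

Definition kspace (theta : 'End(g)) : {vspace g} := fixedSpace theta.
Definition pspace (theta : 'End(g)) : {vspace g} := lker (theta + \1)%VF.

Definition abelian_subspace (a : {vspace g}) : Prop :=
  forall X Y, X \in a -> Y \in a -> lie X Y = 0.

Definition maximal_abelian_in (p a : {vspace g}) : Prop :=
  [/\ (a <= p)%VS, abelian_subspace a
    & forall b : {vspace g},
        (a <= b)%VS -> (b <= p)%VS -> abelian_subspace b -> b = a].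

(* The dual of [a]; elements of [a] have type [subvs_of a]. *)
Definition dual_space (a : {vspace g}) := 'Hom(subvs_of a, R^o).

Definition root_space (a : {vspace g}) (al : dual_space a) : set g :=
  [set X | forall H : subvs_of a, lie (vsval H) X = al H *: X].

Definition restricted_root (a : {vspace g}) (al : dual_space a) : Prop :=
  al != 0 /\ exists2 X, root_space al X & X != 0.

Definition nat_comb (a : {vspace g}) (n : nat) (Pi : n.-tuple (dual_space a))
  (be : dual_space a) : Prop :=
  exists c : 'I_n -> nat, be = \sum_(i < n) (c i)%:R *: tnth Pi i.

Definition root_basis (a : {vspace g}) (n : nat) (Pi : n.-tuple (dual_space a)) :
  Prop :=
  [/\ basis_of fullv Pi, forall i, restricted_root (tnth Pi i)
    & forall be, restricted_root be -> nat_comb Pi be \/ nat_comb Pi (- be)].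

Definition positive_root (a : {vspace g}) (n : nat) (Pi : n.-tuple (dual_space a))
  (be : dual_space a) : Prop := restricted_root be /\ nat_comb Pi be.

Definition highest_root (a : {vspace g}) (n : nat) (Pi : n.-tuple (dual_space a))
  (be : dual_space a) : Prop :=
  restricted_root be /\ forall ga, restricted_root ga -> nat_comb Pi (be - ga).

(* [T] is the element of [a] for which [H |-> H - al H *: T] is the reflection
   in the kernel of [al], orthogonal for the Killing form. *)
Definition coroot (a : {vspace g}) (al : dual_space a) (T : subvs_of a) : Prop :=
  al T = 2 /\ forall H, al H = 0 -> killing (vsval T) (vsval H) = 0.

Inductive weyl_group (a : {vspace g}) : set (subvs_of a -> subvs_of a) :=
| weyl_id : weyl_group id
| weyl_reflection w al T :
    restricted_root al -> coroot al T -> weyl_group w ->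
    weyl_group (fun H => w H - al (w H) *: T).

Definition weyl_orbit (a : {vspace g}) (H : subvs_of a) : set (subvs_of a) :=
  [set w H | w in weyl_group (a := a)].

Definition convex_hull (V : vectType R) (S : set V) : set V :=
  smallest (@convex_set R V) S.

Definition coordinates (V : vectType R) (X : V) : 'rV[R]_(\dim {:V}) :=
  \row_i coord (vbasis {:V}) i X.

(* Interior for the vector space topology, transported from row vectors. *)
Definition vinterior (V : vectType R) (S : set V) : set V :=
  [set X | interior (@coordinates V @` S) (@coordinates V X)].

Definition OmegaH (a : {vspace g}) (ZH : subvs_of a) : set (subvs_of a) :=
  vinterior (convex_hull (weyl_orbit ZH)).

Definition grading_sign (Z : g) (sigma : 'End(g)) : Prop :=
  forall (j : int) X, lie Z X = j%:~R *: X -> sigma X = (-1) ^ j *: X.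

(* The sum of the positive root spaces. *)
Definition nilpotent_part (a : {vspace g}) (n : nat)
  (Pi : n.-tuple (dual_space a)) : set g :=
  [set X | exists (m : nat) (al : 'I_m -> dual_space a) (E : 'I_m -> g),
     (forall i, positive_root Pi (al i) /\ root_space (al i) (E i)) /\
     X = \sum_(i < m) E i].

End Algebra.

Section MatrixGroups.
Context {R : realType} {N : nat}.
Local Notation M := 'M[Cx R]_N.

Definition expm (X : M) : M :=
  lim (series (fun k => (k`!%:R)^-1 *: X ^+ k) @ \oo).

Definition matrix_group (G : set M) : Prop :=
  [/\ forall x, G x -> x \in unitmx, G 1%:M,
      forall x y, G x -> G y -> G (x *m y)
    & forall x, G x -> G (invmx x)].

Definition generated (S : set M) : set M := smallest matrix_group S.

(* Closed in the general linear group. *)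
Definition linear_lie_group (G : set M) : Prop :=
  matrix_group G /\ forall x, closure G x -> x \in unitmx -> G x.

Definition lie_of (G : set M) : set M :=
  [set X | forall t : R, G (expm (realC t *: X))].

Definition group_endomorphism (G : set M) (Phi : M -> M) : Prop :=
  (forall x, G x -> G (Phi x)) /\
  (forall x y, G x -> G y -> Phi (x *m y) = Phi x *m Phi y).

Definition fixed_points (G : set M) (Phi : M -> M) : set M :=
  [set x | G x /\ Phi x = x].

Definition coset (x : M) (S : set M) : set M := [set x *m s | s in S].

End MatrixGroups.

Section Groups.
Context {R : realType} {g : lieAlgebra R} {N : nat}.
Local Notation M := 'M[Cx R]_N.
Implicit Types (iota : g -> M) (G GC K KC : set M).

(* [iota X + i iota Y]: the element X + iY of the complexification of [g]. *)
Definition cplx iota (X Y : g) : M := iota X + imC R *: iota Y.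

(* The complex linear extension of [iota] is required to be injective, so that
   [iota g + i iota g] is the complexification of [g]. *)
Definition matrix_embedding iota : Prop :=
  [/\ forall (c : R) X Y, iota (c *: X + Y) = realC c *: iota X + iota Y,
      forall X Y, iota (lie X Y) = iota X *m iota Y - iota Y *m iota X
    & forall X Y, cplx iota X Y = 0 -> X = 0 /\ Y = 0].

Definition connected_group_of iota G : Prop :=
  [/\ linear_lie_group G, connected G & lie_of G = range iota].

Definition connected_complexification_of iota G GC : Prop :=
  [/\ linear_lie_group GC, connected GC, G `<=` GC
    & lie_of GC = [set cplx iota X Y | X in setT & Y in setT]].

Definition exponentiates iota (phi : g -> g) G (Phi : M -> M) : Prop :=
  group_endomorphism G Phi /\
  forall X, Phi (expm (iota X)) = expm (iota (phi X)).

Definition complex_exponentiates iota (phi : g -> g) GC (Phi : M -> M) :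
  Prop :=
  group_endomorphism GC Phi /\
  forall X Y, Phi (expm (cplx iota X Y)) = expm (cplx iota (phi X) (phi Y)).

(* The complexification inside [GC] of a subgroup [K] with Lie algebra [k]:
   the group K exp(ik). *)
Definition complexified_subgroup iota (k : {vspace g}) K : set M :=
  generated
    (K `|` [set expm (cplx iota X Y) | X in [set` k] & Y in [set` k]]).

Definition torusA iota (a : {vspace g}) : set M :=
  [set expm (iota (vsval H)) | H in [set: subvs_of a]].

Definition centralizerM KC (A : set M) : set M :=
  [set m | KC m /\ forall x, A x -> m *m x = x *m m].

Definition unipotentNC iota (a : {vspace g}) (n : nat)
  (Pi : n.-tuple (dual_space a)) : set M :=
  [set expm (cplx iota X Y) | X in nilpotent_part Pi & Y in nilpotent_part Pi].

Definition set_mulmx (S T : set M) : set M := [set s *m t | s in S & t in T].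

(* Homogeneous spaces are sets of left cosets. *)
Definition Xi GC (MC NC : set M) : set (set M) :=
  [set coset x (set_mulmx MC NC) | x in GC].

(* For [xi = x . xi_o], this is the image of [x NC] in [GC / KC]; it does not
   depend on [x], since [MC] normalizes [NC]. *)
Definition horosphere GC KC (MC NC : set M) (xi : set M) : set (set M) :=
  [set u | exists x y, [/\ GC x, xi = coset x (set_mulmx MC NC), NC y
                         & u = coset (x *m y) KC]].

(* G/H realized as the orbit of [zH . x_o] in [GC / KC]. *)
Definition causal_orbit G KC (zH : M) : set (set M) :=
  [set coset (x *m zH) KC | x in G].

Definition Xi_nr G GC KC (MC NC : set M) (zH : M) : set (set M) :=
  [set xi | Xi GC MC NC xi /\
     horosphere GC KC MC NC xi `&` causal_orbit G KC zH = set0].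

Definition Xi_plus iota (a : {vspace g}) (Omega : set (subvs_of a)) G
  (MC NC : set M) : set (set M) :=
  [set coset (x *m expm (cplx iota 0 (vsval X))) (set_mulmx MC NC)
     | x in G & X in Omega].

End Groups.

(* Main.v *)
(** Suppose that the horosphere of x exp(iX) xi_o meets the orbit of z_H. In
    G_C this reads h z_H k = exp(iX) m n with h in G, k in K_C, m in M_C and n
    in N_C, and only the adjoint action on the complexified Lie algebra matters.
    Use a real basis of restricted weight vectors that is orthogonal for the
    form b(X, Y) = -B(X, theta Y). Then Ad h is real, Ad k and Ad m preserve the
    dual form b^-1, Ad z_H and Ad exp(iX) are diagonal, and n is unitriangular
    for the height of the weights, a property which conjugation by the weight
    preserving operator Ad(exp(iX) m) keeps. Comparing the images of b^-1 under
    both sides gives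
        A (z^2 b^-1) A^T = U (w^2 b^-1) U^T,
    where A is real, U unitriangular, z_j = exp(i pi alpha_j(Z) / 2) and
    w_j = exp(i alpha_j(X)).
    The left side is real, since alpha_j(Z) is -1, 0 or 1, and it is indefinite,
    since z_j^2 = -1 for the highest root. On the right, uniqueness of the LDL^T
    decomposition makes U and w^2 real; as |alpha_j(X)| < pi/2 on Omega_H, a real
    w_j^2 is positive, so the right side is positive: a contradiction.
    The bound on Omega_H only needs that Weyl reflections permute the restricted
    roots; they are induced by rotations exp(E + theta E) in G. *)

Require Import Defs.
From HB Require Import structures.
From mathcomp Require Import all_boot all_order all_algebra.
From mathcomp Require Import complex.
From mathcomp Require Import all_classical all_reals all_analysis.
From mathcomp Require Import ring lra spectral.
Set Implicit Arguments.
Unset Strict Implicit.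
Unset Printing Implicit Defensive.
Import Order.TTheory GRing.Theory Num.Theory.
Import numFieldNormedType.Exports.
Local Open Scope classical_set_scope.
Local Open Scope ring_scope.

(** * The matrix exponential *)

Section ComplexModulus.
Context {R : realType}.
Implicit Types x y z : Cx R.

(** The norm of [Cx R] takes its values in [Cx R]; this real copy allows estimates and limits in
    [R]. *)
Definition cmod x : R := Normc.normc x.

Lemma cmodE x : `|x| = realC (cmod x).
Proof. by []. Qed.

Lemma cmodD x y : cmod (x + y) <= cmod x + cmod y.
Proof. exact: le_normcD. Qed.

Lemma cmodM x y : cmod (x * y) = cmod x * cmod y.
Proof. exact: Normc.normcM. Qed.

Lemma cmod0 : cmod 0 = 0.
Proof. exact: Normc.normc0. Qed.

Lemma cmodN x : cmod (- x) = cmod x.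
Proof. exact: normcN. Qed.

Lemma cmod_ge0 x : 0 <= cmod x.
Proof. by case: x => a b; exact: sqrtr_ge0. Qed.

Lemma cmod_eq0 x : cmod x = 0 -> x = 0.
Proof. exact: Normc.eq0_normc. Qed.

Lemma cmod_realC (r : R) : cmod (realC r) = `|r|.
Proof. by rewrite /cmod /= expr0n /= addr0 sqrtr_sqr. Qed.

Lemma cmodV x : cmod x^-1 = (cmod x)^-1.
Proof. exact: Normc.normcV. Qed.

Lemma cmod_nat n : cmod n%:R = n%:R.
Proof.
have -> : (n%:R : Cx R) = realC n%:R by rewrite /realC rmorph_nat.
by rewrite cmod_realC normr_nat.
Qed.

Lemma Re_le_cmod x : `|complex.Re x| <= cmod x.
Proof.
case: x => a b; rewrite /cmod /= -(sqrtr_sqr a).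
by apply: ler_wsqrtr; rewrite lerDl sqr_ge0.
Qed.

Lemma Im_le_cmod x : `|complex.Im x| <= cmod x.
Proof.
case: x => a b; rewrite /cmod /= -(sqrtr_sqr b).
by apply: ler_wsqrtr; rewrite lerDr sqr_ge0.
Qed.

Lemma cmod_le_ReIm x : cmod x <= `|complex.Re x| + `|complex.Im x|.
Proof.
case: x => a b; rewrite /cmod /=.
rewrite -[leRHS]ger0_norm ?addr_ge0 // -sqrtr_sqr ler_wsqrtr // sqrrD.
by rewrite !real_normK ?num_real // lerD2r lerDl mulrn_wge0 // mulr_ge0.
Qed.

Lemma cmod_sum (I : Type) (r : seq I) (P : pred I) (F : I -> Cx R) :
  cmod (\sum_(i <- r | P i) F i) <= \sum_(i <- r | P i) cmod (F i).
Proof.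
elim/big_ind2: _ => //; first by rewrite cmod0.
by move=> x1 y1 x2 y2 h1 h2; apply: le_trans (cmodD _ _) (lerD h1 h2).
Qed.

Lemma realC_real (r : R) : realC r \is Num.real.
Proof. by rewrite realE /realC (lecR 0 r) (lecR r 0) le_total. Qed.

End ComplexModulus.

(** * A submultiplicative matrix norm and its convergence *)

Section MatrixNorm.
Context {R : realType}.

(** The entrywise l1 norm is submultiplicative, unlike the maximum norm behind the topology of
    matrices. *)
Definition nrm m n (A : 'M[Cx R]_(m, n)) : R := \sum_i \sum_j cmod (A i j).

Lemma nrm_ge0 m n (A : 'M[Cx R]_(m, n)) : 0 <= nrm A.
Proof. by apply: sumr_ge0 => i _; apply: sumr_ge0 => j _; exact: cmod_ge0. Qed.

Lemma nrm_entry m n (A : 'M[Cx R]_(m, n)) i j : cmod (A i j) <= nrm A.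
Proof.
rewrite /nrm (bigD1 i) //= (bigD1 j) //= -addrA lerDl addr_ge0 //.
  by apply: sumr_ge0 => l _; exact: cmod_ge0.
by apply: sumr_ge0 => k _; apply: sumr_ge0 => l _; exact: cmod_ge0.
Qed.

Lemma nrm_eq0 m n (A : 'M[Cx R]_(m, n)) : nrm A <= 0 -> A = 0.
Proof.
move=> A0; apply/matrixP => i j; rewrite mxE; apply: cmod_eq0.
by apply/le_anti; rewrite cmod_ge0 (le_trans (nrm_entry A i j)).
Qed.

Lemma nrm0 m n : nrm (0 : 'M[Cx R]_(m, n)) = 0.
Proof. by apply: big1 => i _; apply: big1 => j _; rewrite mxE cmod0. Qed.

Lemma nrmD m n (A B : 'M[Cx R]_(m, n)) : nrm (A + B) <= nrm A + nrm B.
Proof.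
rewrite /nrm -big_split /=; apply: ler_sum => i _.
by rewrite -big_split /=; apply: ler_sum => j _; rewrite mxE cmodD.
Qed.

Lemma nrmN m n (A : 'M[Cx R]_(m, n)) : nrm (- A) = nrm A.
Proof. by apply: eq_bigr => i _; apply: eq_bigr => j _; rewrite mxE cmodN. Qed.

Lemma nrmZ m n c (A : 'M[Cx R]_(m, n)) : nrm (c *: A) = cmod c * nrm A.
Proof.
rewrite /nrm mulr_sumr; apply: eq_bigr => i _; rewrite mulr_sumr.
by apply: eq_bigr => j _; rewrite mxE cmodM.
Qed.

Lemma nrmM m n p (A : 'M[Cx R]_(m, n)) (B : 'M[Cx R]_(n, p)) :
  nrm (A *m B) <= nrm A * nrm B.
Proof.
rewrite {1}/nrm.
have -> : nrm A * nrm B = \sum_i \sum_j cmod (A i j) * nrm B.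
  rewrite [nrm A]/nrm mulr_suml; apply: eq_bigr => i _.
  by rewrite mulr_suml.
apply: ler_sum => i _.
apply: (@le_trans _ _ (\sum_k \sum_j cmod (A i j) * cmod (B j k))).
  apply: ler_sum => k _; rewrite mxE (le_trans (cmod_sum _ _ _)) //.
  by apply: ler_sum => j _; rewrite cmodM.
rewrite exchange_big /=; apply: ler_sum => j _.
rewrite -mulr_sumr ler_wpM2l ?cmod_ge0 // /nrm (bigD1 j) //= lerDl.
by apply: sumr_ge0 => k _; apply: sumr_ge0 => l _; exact: cmod_ge0.
Qed.

Lemma nrm_sum m n (I : Type) (r : seq I) (P : pred I)
    (F : I -> 'M[Cx R]_(m, n)) :
  nrm (\sum_(i <- r | P i) F i) <= \sum_(i <- r | P i) nrm (F i).
Proof.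
elim/big_ind2: _ => //; first by rewrite nrm0.
by move=> x1 y1 x2 y2 h1 h2; apply: le_trans (nrmD _ _) (lerD h1 h2).
Qed.

Lemma nrm_mulX m n (B : 'M[Cx R]_(m, n)) (A : 'M[Cx R]_n) k :
  nrm (B *m A ^+ k) <= nrm B * nrm A ^+ k.
Proof.
elim: k => [|k IH]; first by rewrite !expr0 mulmx1 mulr1.
rewrite exprSr -mulmxE mulmxA (le_trans (nrmM _ _)) //.
by rewrite exprSr mulrA ler_wpM2r ?nrm_ge0.
Qed.

Lemma nrm_Xmul m n (A : 'M[Cx R]_m) (B : 'M[Cx R]_(m, n)) k :
  nrm (A ^+ k *m B) <= nrm A ^+ k * nrm B.
Proof.
elim: k => [|k IH]; first by rewrite !expr0 mul1mx mul1r.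
rewrite !exprS -mulmxE -mulmxA (le_trans (nrmM _ _)) //.
by rewrite -mulrA ler_wpM2l ?nrm_ge0.
Qed.

(** Convergence is tested on a real sequence; [ncvg_cvg] carries it to the topology in which [expm]
    is a limit. *)
Definition ncvg m n (u : nat -> 'M[Cx R]_(m, n)) (l : 'M[Cx R]_(m, n)) : Prop :=
  (fun k => nrm (u k - l)) @ \oo --> (0 : R).

Lemma ncvg_le m n (u : nat -> 'M[Cx R]_(m, n)) l (e : nat -> R) :
  (forall k, nrm (u k - l) <= e k) -> e @ \oo --> (0 : R) -> ncvg u l.
Proof.
move=> ue e0; apply: (@squeeze_cvgr _ _ _ _ (fun=> 0) e).
- by apply: nearW => k; rewrite nrm_ge0 ue.
- exact: cvg_cst.
- exact: e0.
Qed.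

Lemma ncvg_unique m n (u : nat -> 'M[Cx R]_(m, n)) l l' :
  ncvg u l -> ncvg u l' -> l = l'.
Proof.
move=> ul ul'; apply/eqP; rewrite -subr_eq0; apply/eqP/nrm_eq0.
have h : (fun k => nrm (u k - l) + nrm (u k - l')) @ \oo --> (0 : R).
  by rewrite -[0 in X in _ --> X]addr0; exact: cvgD.
have := cvg_lim (@Rhausdorff R) h => <-.
apply: limr_ge; first by apply/cvg_ex; exists 0.
apply: nearW => k; rewrite -[nrm (u k - l)]nrmN opprB.
by rewrite (le_trans _ (nrmD _ _)) // addrA subrK.
Qed.

Lemma ncvg_mull m n p (B : 'M[Cx R]_(p, m)) (u : nat -> 'M[Cx R]_(m, n)) l :
  ncvg u l -> ncvg (fun k => B *m u k) (B *m l).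
Proof.
move=> ul; apply: (@ncvg_le _ _ _ _ (fun k => nrm B * nrm (u k - l))).
  by move=> k; rewrite -mulmxBr nrmM.
by rewrite -(mulr0 (nrm B)); apply: cvgM => //; exact: cvg_cst.
Qed.

Lemma ncvg_mulr m n p (B : 'M[Cx R]_(n, p)) (u : nat -> 'M[Cx R]_(m, n)) l :
  ncvg u l -> ncvg (fun k => u k *m B) (l *m B).
Proof.
move=> ul; apply: (@ncvg_le _ _ _ _ (fun k => nrm (u k - l) * nrm B)).
  by move=> k; rewrite -mulmxBl nrmM.
by rewrite -(mul0r (nrm B)); apply: cvgM => //; exact: cvg_cst.
Qed.

Lemma ncvgB m n (u v : nat -> 'M[Cx R]_(m, n)) l l' :
  ncvg u l -> ncvg v l' -> ncvg (fun k => u k - v k) (l - l').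
Proof.
move=> ul vl.
apply: (@ncvg_le _ _ _ _ (fun k => nrm (u k - l) + nrm (v k - l'))).
  move=> k; rewrite -[nrm (v k - l')]nrmN (le_trans _ (nrmD _ _)) //.
  by rewrite !opprD !opprK addrACA.
by rewrite -[0 in X in _ --> X]addr0; exact: cvgD.
Qed.

Lemma ncvg_eq m n (u v : nat -> 'M[Cx R]_(m, n)) l : u =1 v -> ncvg u l -> ncvg v l.
Proof. by move=> /funext ->. Qed.

(* The topology of 'M[Cx R]_(m, n) comes from a norm with values in Cx R. *)
Lemma ncvg_cvg m n (u : nat -> 'M[Cx R]_(m, n)) l : ncvg u l -> u @ \oo --> l.
Proof.
move=> /cvgrPdist_lt ul; apply/cvgrPdist_lt => e e0.
(* Positivity in [Cx R] includes a vanishing imaginary part. *)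
have [re e'0] : e = realC (complex.Re e) /\ 0 < complex.Re e.
  move: e e0 => [a b]; rewrite ltcE /= => /andP[/eqP -> a0].
  by split.
near=> k.
have : `|0 - nrm (u k - l)| < complex.Re e by near: k; exact: ul.
rewrite sub0r normrN ger0_norm ?nrm_ge0 // => h.
rewrite re distrC.
apply: (@le_lt_trans _ _ (realC (nrm (u k - l)))); last by rewrite /realC ltcR.
have [->|nz] := eqVneq `|u k - l| 0.
  by rewrite /realC (lecR 0) nrm_ge0.
(* A nonzero maximum norm is attained at some entry, and [nrm] dominates every entry. *)
case: (mx_norm_neq0 nz) => i nE.
have -> : `|u k - l| = `|(u k - l) i.1 i.2| by exact: nE.
by rewrite cmodE /realC lecR nrm_entry.
Unshelve. all: by end_near. Qed.

End MatrixNorm.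

(** * Dominated matrix series and the exponential *)

Section Exponential.
Context {R : realType}.

Lemma ReD (x y : Cx R) : complex.Re (x + y) = complex.Re x + complex.Re y.
Proof. by case: x y => [? ?] []. Qed.

Lemma ImD (x y : Cx R) : complex.Im (x + y) = complex.Im x + complex.Im y.
Proof. by case: x y => [? ?] []. Qed.

Lemma ReB (x y : Cx R) : complex.Re (x - y) = complex.Re x - complex.Re y.
Proof. by case: x y => [? ?] []. Qed.

Lemma ImB (x y : Cx R) : complex.Im (x - y) = complex.Im x - complex.Im y.
Proof. by case: x y => [? ?] []. Qed.

Lemma cvgr0_sum (I : Type) (r : seq I) (f : I -> nat -> R) :
  (forall i, f i @ \oo --> (0 : R)) ->
  (fun k => \sum_(i <- r) f i k) @ \oo --> (0 : R).
Proof.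
move=> f0; elim: r => [|i r IH].
  have -> : (fun k => \sum_(i <- [::]) f i k) = (fun=> 0).
    by apply/funext => k; rewrite big_nil.
  exact: cvg_cst.
have -> : (fun k => \sum_(j <- i :: r) f j k) =
    (fun k => f i k + \sum_(j <- r) f j k).
  by apply/funext => k; rewrite big_cons.
by rewrite -[0 in X in _ --> X]addr0; exact: cvgD.
Qed.

Lemma cvgr0_norm (u : nat -> R) l :
  u @ \oo --> l -> (fun k => `|u k - l|) @ \oo --> (0 : R).
Proof.
move=> ul; rewrite -(normr0 R) -(subrr l); apply: cvg_norm.
by apply: cvgB => //; exact: cvg_cst.
Qed.

Lemma ncvg_ReIm m n (u : nat -> 'M[Cx R]_(m, n)) (a b : 'I_m -> 'I_n -> R) :
  (forall i j, (fun k => complex.Re (u k i j)) @ \oo --> a i j) ->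
  (forall i j, (fun k => complex.Im (u k i j)) @ \oo --> b i j) ->
  ncvg u (\matrix_(i, j) (Complex (a i j) (b i j) : Cx R)).
Proof.
move=> ua ub; apply: (@ncvg_le _ _ _ _ _ (fun k => \sum_i \sum_j
  (`|complex.Re (u k i j) - a i j| + `|complex.Im (u k i j) - b i j|))).
  move=> k; apply: ler_sum => i _; apply: ler_sum => j _.
  by rewrite !mxE (le_trans (cmod_le_ReIm _)) // ReB ImB.
apply: cvgr0_sum => i; apply: cvgr0_sum => j.
by rewrite -[0 in X in _ --> X]addr0; apply: cvgD; exact: cvgr0_norm.
Qed.

(** The real and imaginary parts of every entry are dominated by [e], so they form absolutely
    convergent real series. *)
Lemma series_ncvg m n (x : nat -> 'M[Cx R]_(m, n)) (e : nat -> R) :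
  (forall k, nrm (x k) <= e k) -> cvgn (series e) ->
  exists l, ncvg (series x) l.
Proof.
move=> xe ecvg.
have dom (f : nat -> R) : (forall k, `|f k| <= e k) -> cvgn (series f).
  move=> fe; apply: normed_cvg; apply: series_le_cvg (ecvg) => k.
  - exact: normr_ge0.
  - exact: le_trans (normr_ge0 _) (fe k).
  - exact: fe.
have cRe i j : cvgn (series (fun k => complex.Re (x k i j))).
  by apply: dom => k; rewrite (le_trans (Re_le_cmod _)) // (le_trans (nrm_entry _ _ _)).
have cIm i j : cvgn (series (fun k => complex.Im (x k i j))).
  by apply: dom => k; rewrite (le_trans (Im_le_cmod _)) // (le_trans (nrm_entry _ _ _)).
eexists; apply: ncvg_ReIm => i j.
- have -> : (fun k => complex.Re (series x k i j)) =
    series (fun k => complex.Re (x k i j)); last exact: cRe.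
  apply/funext => k; rewrite /series /= summxE.
  by rewrite (big_morph (@complex.Re R) ReD erefl).
- have -> : (fun k => complex.Im (series x k i j)) =
    series (fun k => complex.Im (x k i j)); last exact: cIm.
  apply/funext => k; rewrite /series /= summxE.
  by rewrite (big_morph (@complex.Im R) ImD erefl).
Qed.

Definition expterm n (A : 'M[Cx R]_n) (k : nat) : 'M[Cx R]_n :=
  (k`!%:R)^-1 *: A ^+ k.

Lemma nrm_expterm_mul n p (A : 'M[Cx R]_n) (B : 'M[Cx R]_(n, p)) k :
  nrm (expterm A k *m B) <= exp_coeff (nrm A) k * nrm B.
Proof.
rewrite -scalemxAl nrmZ cmodV cmod_nat /exp_coeff /= [nrm A ^+ _ / _]mulrC.
by rewrite -mulrA ler_wpM2l ?invr_ge0 // nrm_Xmul.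
Qed.

Lemma nrm_mul_expterm n p (A : 'M[Cx R]_n) (B : 'M[Cx R]_(p, n)) k :
  nrm (B *m expterm A k) <= nrm B * exp_coeff (nrm A) k.
Proof.
rewrite -scalemxAr nrmZ cmodV cmod_nat /exp_coeff /= [nrm A ^+ _ / _]mulrC.
by rewrite [leRHS]mulrCA ler_wpM2l ?invr_ge0 // nrm_mulX.
Qed.

Lemma expm_ncvg n (A : 'M[Cx R]_n) : ncvg (series (expterm A)) (expm A).
Proof.
have [l Al] : exists l, ncvg (series (expterm A)) l.
  apply: (@series_ncvg _ _ _ (nrm (1%:M : 'M[Cx R]_n) *: exp_coeff (nrm A))).
    by move=> k; rewrite -[expterm A k]mul1mx nrm_mul_expterm.
  exact/is_cvg_seriesZ/is_cvg_series_exp_coeff.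
suff -> : expm A = l by [].
by apply: cvg_lim (ncvg_cvg Al); exact: norm_hausdorff.
Qed.

(** Powers are intertwined term by term, and multiplication by [J] is continuous. *)
Lemma expm_intertwine m n (A : 'M[Cx R]_m) (B : 'M[Cx R]_n) (J : 'M[Cx R]_(m, n)) :
  A *m J = J *m B -> expm A *m J = J *m expm B.
Proof.
move=> AJ; apply: (ncvg_unique (ncvg_mulr J (expm_ncvg A))).
apply: ncvg_eq (ncvg_mull J (expm_ncvg B)) => k.
rewrite /series /= mulmx_suml mulmx_sumr; apply: eq_bigr => i _.
rewrite -scalemxAl -scalemxAr; congr (_ *: _).
elim: i => [|i IH]; first by rewrite !expr0 mulmx1 mul1mx.
by rewrite !exprSr -!mulmxE mulmxA IH -!mulmxA AJ.
Qed.

Lemma expm_conj n (P A B : 'M[Cx R]_n) :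
  P *m A = B *m P -> P *m expm A = expm B *m P.
Proof. by move=> PA; rewrite (expm_intertwine (esym PA)). Qed.

Lemma expm0 n : expm (0 : 'M[Cx R]_n) = 1%:M.
Proof.
apply: (ncvg_unique (expm_ncvg 0)).
(* The partial sum of index 0 is empty, so the sequence is constant only from index 1 on. *)
rewrite /ncvg -cvg_shiftS; apply: cvg_near_cst; apply: nearW => k.
rewrite /series /= big_nat_recl // big1 => [|i _].
  by rewrite /expterm expr0 fact0 invr1 scale1r addr0 subrr nrm0.
by rewrite /expterm expr0n /= scaler0.
Qed.

End Exponential.

(** * Cauchy products of exponential series *)

Section CauchyProduct.

(** Both sides run over the pairs with j + l < n, once along antidiagonals and once along
    columns. *)
Lemma sum_triangle (V : nmodType) (F : nat -> nat -> V) n :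
  \sum_(0 <= m < n) \sum_(0 <= j < m.+1) F j (m - j)%N =
  \sum_(0 <= j < n) \sum_(0 <= l < n - j) F j l.
Proof.
elim: n => [|n IH]; first by rewrite !big_geq.
rewrite big_nat_recr //= IH [RHS]big_nat_recr //= subSnn.
rewrite [in LHS]big_nat_recr //= subnn [in RHS]big_nat1 addrA; congr (_ + _).
rewrite -big_split /=; apply: eq_big_nat => j /andP[_ jn].
by rewrite subSn ?(ltnW jn) // big_nat_recr.
Qed.

(** The partial sums of a Cauchy product miss the corner j + l >= n of the square; this corner is
    the remainder to estimate. *)
Lemma sum_square_triangle (V : zmodType) (F : nat -> nat -> V) n :
  \sum_(0 <= j < n) \sum_(0 <= l < n) F j l -
    \sum_(0 <= m < n) \sum_(0 <= j < m.+1) F j (m - j)%N =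
  \sum_(0 <= j < n) \sum_(n - j <= l < n) F j l.
Proof.
rewrite sum_triangle -sumrB; apply: eq_big_nat => j _.
by rewrite (big_cat_nat (leq0n (n - j)) (leq_subr j n)) /= addrAC subrr add0r.
Qed.

Context {R : realType}.

Lemma exp_coeffD (s w : R) m :
  \sum_(0 <= j < m.+1) exp_coeff s j * exp_coeff w (m - j)%N = exp_coeff (s + w) m.
Proof.
rewrite /exp_coeff /= addrC exprDn mulr_suml big_mkord; apply: eq_bigr => j _.
have jm : (j <= m)%N by rewrite -ltnS.
rewrite -mulr_natr -(bin_fact jm) !natrM.
have h1 : (j`!%:R : R) != 0 by rewrite pnatr_eq0 -lt0n fact_gt0.
have h2 : ((m - j)`!%:R : R) != 0 by rewrite pnatr_eq0 -lt0n fact_gt0.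
have h3 : ('C(m, j)%:R : R) != 0 by rewrite pnatr_eq0 -lt0n bin_gt0.
by field; rewrite h1 h2 h3.
Qed.

(** The corner is the square minus the triangle, which tends to e^s e^w - e^(s + w) = 0. Taken at
    norms of matrices, it bounds the remainder of a matrix Cauchy product. *)
Lemma exp_remainder_cvg0 (s w : R) :
  (fun n => \sum_(0 <= j < n) \sum_(n - j <= l < n)
     exp_coeff s j * exp_coeff w l) @ \oo --> (0 : R).
Proof.
have -> : (fun n => \sum_(0 <= j < n) \sum_(n - j <= l < n)
     exp_coeff s j * exp_coeff w l) =
   (fun n => series (exp_coeff s) n * series (exp_coeff w) n
     - series (exp_coeff (s + w)) n).
  apply/funext => n; rewrite -sum_square_triangle; congr (_ - _).
    by rewrite /series /= mulr_suml; apply: eq_bigr => j _; rewrite mulr_sumr.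
  by rewrite /series /=; apply: eq_bigr => m _; rewrite exp_coeffD.
have -> : (0 : R) = expR s * expR w - expR (s + w) by rewrite expRD subrr.
by apply: cvgB; [apply: cvgM|]; exact: is_cvg_series_exp_coeff.
Qed.

End CauchyProduct.

(** * The identity Ad(exp W) = exp(ad W) *)

Section Adjoint.
Context {R : realType}.

Lemma cvgr0_mull (c : R) (u : nat -> R) :
  u @ \oo --> (0 : R) -> (fun k => c * u k) @ \oo --> (0 : R).
Proof. by move=> u0; rewrite -(mulr0 c); apply: cvgM => //; exact: cvg_cst. Qed.

Lemma cvgr0_mulr (c : R) (u : nat -> R) :
  u @ \oo --> (0 : R) -> (fun k => u k * c) @ \oo --> (0 : R).
Proof. by move=> u0; rewrite -(mul0r c); apply: cvgM => //; exact: cvg_cst. Qed.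

(** The coordinates are complex while [E] will be the image of a real basis, so these combinations
    fill the complexified Lie algebra. *)
Definition lincomb d N (E : 'I_d -> 'M[Cx R]_N) (v : 'cV[Cx R]_d) : 'M[Cx R]_N :=
  \sum_k v k 0 *: E k.

Lemma lincombZ d N (E : 'I_d -> 'M[Cx R]_N) c v :
  lincomb E (c *: v) = c *: lincomb E v.
Proof.
by rewrite /lincomb scaler_sumr; apply: eq_bigr => k _; rewrite mxE scalerA.
Qed.

Lemma lincombD d N (E : 'I_d -> 'M[Cx R]_N) v w :
  lincomb E (v + w) = lincomb E v + lincomb E w.
Proof.
by rewrite /lincomb -big_split /=; apply: eq_bigr => k _; rewrite mxE scalerDl.
Qed.

Lemma lincombB d N (E : 'I_d -> 'M[Cx R]_N) v w :
  lincomb E (v - w) = lincomb E v - lincomb E w.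
Proof.
by rewrite /lincomb -sumrB; apply: eq_bigr => k _; rewrite !mxE scalerBl.
Qed.

Lemma lincomb_sum d N (E : 'I_d -> 'M[Cx R]_N) I (r : seq I) (f : I -> 'cV_d) :
  lincomb E (\sum_(i <- r) f i) = \sum_(i <- r) lincomb E (f i).
Proof.
apply: (big_morph (lincomb E) (lincombD E)).
by rewrite /lincomb big1 // => k _; rewrite mxE scale0r.
Qed.

Lemma nrm_lincomb d N (E : 'I_d -> 'M[Cx R]_N) v :
  nrm (lincomb E v) <= nrm v * \sum_k nrm (E k).
Proof.
rewrite /lincomb (le_trans (nrm_sum _ _ _)) // mulr_sumr; apply: ler_sum => k _.
by rewrite nrmZ ler_wpM2r ?nrm_ge0 ?nrm_entry.
Qed.

Lemma expterm_S n (A : 'M[Cx R]_n) k :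
  A *m expterm A k = k.+1%:R *: expterm A k.+1.
Proof.
rewrite /expterm -scalemxAr mulmxE -exprS scalerA factS natrM invfM mulrA.
by rewrite divff ?mul1r // pnatr_eq0.
Qed.

Variables (d N : nat) (E : 'I_d -> 'M[Cx R]_N).
Variables (W : 'M[Cx R]_N) (S : 'M[Cx R]_d).
Hypothesis adW : forall v,
  W *m lincomb E v = lincomb E (S *m v) + lincomb E v *m W.

(** Left multiplication by [W] is the sum of ad W, whose matrix is [S], and of right multiplication
    by [W]. These two commute, so this is the binomial formula divided by m!. *)
Lemma expterm_lincomb v m :
  expterm W m *m lincomb E v =
  \sum_(0 <= j < m.+1) lincomb E (expterm S j *m v) *m expterm W (m - j)%N.
Proof.
elim: m => [|m IH].
  by rewrite big_nat1 /expterm fact0 invr1 !scale1r !expr0 mul1mx mul1mx mulmx1.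
have mS0 : (m.+1%:R : Cx R) != 0 by rewrite pnatr_eq0.
apply: (scalerI mS0); rewrite scalemxAl -expterm_S -mulmxA IH mulmx_sumr.
(* The [a j] are the summands for m + 1. Each is reached by raising either index, with coefficients
   j and m + 1 - j, which add up to m + 1. *)
pose a j := lincomb E (expterm S j *m v) *m expterm W (m.+1 - j)%N.
have -> : \sum_(0 <= j < m.+1)
    W *m (lincomb E (expterm S j *m v) *m expterm W (m - j)%N) =
  \sum_(0 <= j < m.+1) (j.+1%:R *: a j.+1 + (m.+1 - j)%N%:R *: a j).
  apply: eq_big_nat => j /andP[_ jm]; rewrite mulmxA adW mulmxDl; congr (_ + _).
    by rewrite mulmxA expterm_S -scalemxAl lincombZ -scalemxAl.
  by rewrite -mulmxA expterm_S /a subSn // scalemxAr.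
rewrite big_split /= scaler_sumr.
have -> : \sum_(0 <= j < m.+1) j.+1%:R *: a j.+1 =
    \sum_(0 <= j < m.+2) j%:R *: a j.
  by rewrite [in RHS]big_nat_recl // scale0r add0r.
have -> : \sum_(0 <= j < m.+1) (m.+1 - j)%N%:R *: a j =
    \sum_(0 <= j < m.+2) (m.+1 - j)%N%:R *: a j.
  by rewrite [RHS]big_nat_recr //= subnn scale0r addr0.
rewrite -big_split /=; apply: eq_big_nat => j /andP[_ jm].
by rewrite -scalerDl -natrD subnKC.
Qed.

(** Ad(exp W) = exp(ad W), written without inverses. The product of partial sums on the right
    differs from the partial sum on the left by a corner j + l >= n, bounded by the scalar remainder
    at the norms of [S] and [W]. *)
Lemma expm_lincomb v :
  expm W *m lincomb E v = lincomb E (expm S *m v) *m expm W.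
Proof.
set P := series (expterm W); set Q := series (expterm S).
have cP : ncvg P (expm W) := expm_ncvg W.
have cQ : ncvg (fun k => lincomb E (Q k *m v)) (lincomb E (expm S *m v)).
  apply: (@ncvg_le _ _ _ _ _
    (fun k => nrm (Q k *m v - expm S *m v) * \sum_k nrm (E k))).
    move=> k; apply: le_trans (nrm_lincomb _ _).
    by rewrite lincombB.
  apply: cvgr0_mulr.
  exact: (ncvg_mulr v (expm_ncvg S)).
have cQP : ncvg (fun k => lincomb E (Q k *m v) *m P k)
    (lincomb E (expm S *m v) *m expm W).
  pose q := lincomb E (expm S *m v).
  apply: (@ncvg_le _ _ _ _ _ (fun k => nrm (lincomb E (Q k *m v) - q) *
     (nrm (P k - expm W) + nrm (expm W)) + nrm q * nrm (P k - expm W))).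
    move=> k.
    have -> : lincomb E (Q k *m v) *m P k - q *m expm W =
        (lincomb E (Q k *m v) - q) *m (P k - expm W + expm W) +
        q *m (P k - expm W).
      by rewrite subrK mulmxBl mulmxBr addrA subrK.
    apply: (le_trans (nrmD _ _)); apply: lerD; last exact: nrmM.
    by apply: (le_trans (nrmM _ _)); rewrite ler_wpM2l ?nrm_ge0 ?nrmD.
  rewrite -[0 in X in _ --> X]addr0; apply: cvgD; last exact: cvgr0_mull.
  rewrite -(mul0r (0 + nrm (expm W))); apply: cvgM => //.
  by apply: cvgD => //; exact: cvg_cst.
apply: (ncvg_unique (ncvg_mulr _ cP)).
have -> : (fun k => P k *m lincomb E v) =
    (fun k => lincomb E (Q k *m v) *m P k -
       (lincomb E (Q k *m v) *m P k - P k *m lincomb E v)).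
  by apply/funext => k; rewrite opprB addrC subrK.
rewrite -[X in ncvg _ X]subr0; apply: ncvgB => //.
set c := nrm v * \sum_k nrm (E k).
apply: (@ncvg_le _ _ _ _ _ (fun n => c * \sum_(0 <= j < n) \sum_(n - j <= l < n)
     exp_coeff (nrm S) j * exp_coeff (nrm W) l)); last first.
  apply: cvgr0_mull.
  exact: exp_remainder_cvg0.
move=> n; rewrite subr0.
have -> : lincomb E (Q n *m v) *m P n - P n *m lincomb E v =
  \sum_(0 <= j < n) \sum_(n - j <= l < n)
     lincomb E (expterm S j *m v) *m expterm W l.
  rewrite -sum_square_triangle; congr (_ - _).
    rewrite /Q /P /series /= [X in lincomb E X]mulmx_suml lincomb_sum mulmx_suml.
    by apply: eq_bigr => j _; rewrite mulmx_sumr.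
  by rewrite /P /series /= mulmx_suml; apply: eq_bigr => m _; rewrite expterm_lincomb.
rewrite (le_trans (nrm_sum _ _ _)) // mulr_sumr; apply: ler_sum => j _.
rewrite (le_trans (nrm_sum _ _ _)) // mulr_sumr; apply: ler_sum => l _.
rewrite (le_trans (nrm_mul_expterm _ _ _)) // mulrA ler_wpM2r //.
  by rewrite exp_coeff_ge0 ?nrm_ge0.
rewrite (le_trans (nrm_lincomb _ _)) // /c mulrAC ler_wpM2r //.
  by apply: sumr_ge0 => k _; exact: nrm_ge0.
by rewrite [leRHS]mulrC nrm_expterm_mul.
Qed.

End Adjoint.

(** * Eigenvectors, first order expansion and one-parameter groups *)

Section ExponentialProperties.
Context {R : realType}.

Definition cis (t : R) : Cx R := Complex (cos t) (sin t).

(** The two parts are arranged like the numerators of [cos_coeff] and [sin_coeff]. *)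
Lemma imaginary_exp (t : R) j :
  (imC R * realC t) ^+ j = Complex ((~~ odd j)%:R * (-1) ^+ j./2 * t ^+ j)
    (((odd j)%:R * (-1) ^+ j.-1./2 * t ^+ j)) :> Cx R.
Proof.
have itE : imC R * realC t = Complex 0 t :> Cx R.
  by rewrite /imC /realC; congr (Complex _ _); rewrite /=; ring.
elim: j => [|j IH].
  by rewrite !expr0 /= mul0r !mul1r mul0r.
rewrite exprS IH itE.
have mulE (a b c d : R) : (Complex a b : Cx R) * (Complex c d : Cx R) =
    Complex (a * c - b * d) (a * d + b * c) by [].
rewrite mulE /= negbK; case: (boolP (odd j)) => oj /=.
- congr Complex; last by ring.
  have -> : uphalf j = (j.-1)./2.+1 by case: j oj {IH}.
  by rewrite !exprS; ring.
- congr Complex; first by ring.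
  by rewrite exprS; ring.
Qed.

Lemma exp_series_cis (t : R) :
  (fun k => cmod (\sum_(0 <= j < k) (j`!%:R)^-1 * (imC R * realC t) ^+ j - cis t))
    @ \oo --> (0 : R).
Proof.
pose z k := \sum_(0 <= j < k) ((j`!%:R)^-1 * (imC R * realC t) ^+ j : Cx R).
have factE j : ((j`!%:R)^-1 : Cx R) = realC (j`!%:R)^-1.
  by rewrite /realC fmorphV rmorph_nat.
have scaleE (a b c : R) : realC a * (Complex b c : Cx R) = Complex (a * b) (a * c).
  by rewrite /realC; congr Complex; rewrite /=; ring.
have zRe k : complex.Re (z k) = series (cos_coeff t) k.
  rewrite /z (big_morph (@complex.Re R) ReD erefl) /series /=.
  apply: eq_bigr => j _; rewrite imaginary_exp factE scaleE /=.
  by rewrite mulrC.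
have zIm k : complex.Im (z k) = series (sin_coeff t) k.
  rewrite /z (big_morph (@complex.Im R) ImD erefl) /series /=.
  apply: eq_bigr => j _; rewrite imaginary_exp factE scaleE /=.
  by rewrite mulrC.
apply: (@squeeze_cvgr _ _ _ _ (fun=> 0) (fun k =>
  `|series (cos_coeff t) k - cos t| + `|series (sin_coeff t) k - sin t|)).
- apply: nearW => k; rewrite cmod_ge0 (le_trans (cmod_le_ReIm _)) //.
  by rewrite ReB ImB -/(z k) zRe zIm.
- exact: cvg_cst.
- rewrite -[0 in X in _ --> X]addr0; apply: cvgD; apply: cvgr0_norm.
    by rewrite unlock; exact: is_cvg_series_cos_coeff.
  by rewrite unlock; exact: is_cvg_series_sin_coeff.
Qed.

Lemma expm_eigen d (S : 'M[Cx R]_d) (v : 'cV[Cx R]_d) (t : R) :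
  S *m v = (imC R * realC t) *: v -> expm S *m v = cis t *: v.
Proof.
move=> Sv; apply: (ncvg_unique (ncvg_mulr v (expm_ncvg S))).
apply: (@ncvg_le _ _ _ _ _ (fun k =>
  cmod (\sum_(0 <= j < k) (j`!%:R)^-1 * (imC R * realC t) ^+ j - cis t) * nrm v));
  last exact/cvgr0_mulr/exp_series_cis.
move=> k; rewrite -nrmZ scalerBl scaler_suml /series /= mulmx_suml.
have -> : \sum_(0 <= j < k) expterm S j *m v =
    \sum_(0 <= j < k) ((j`!%:R)^-1 * (imC R * realC t) ^+ j) *: v => //.
apply: eq_bigr => j _; rewrite -scalemxAl -scalerA; congr (_ *: _).
elim: j => [|j IH]; first by rewrite !expr0 mul1mx scale1r.
by rewrite exprSr -mulmxE -mulmxA Sv -scalemxAr IH scalerA -exprS.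
Qed.

(** This is Ad(exp W) = exp(ad W) on the line spanned by the eigenvector [Y] of ad W. *)
Lemma expm_eigen_conj n (W Y : 'M[Cx R]_n) (t : R) :
  W *m Y - Y *m W = (imC R * realC t) *: Y ->
  expm W *m Y = cis t *: (Y *m expm W).
Proof.
move=> WY; pose E (_ : 'I_1) := Y.
have combE (v : 'cV_1) : lincomb E v = v 0 0 *: Y by rewrite /lincomb big_ord1.
pose S : 'M[Cx R]_1 := (imC R * realC t)%:M.
have adW v : W *m lincomb E v = lincomb E (S *m v) + lincomb E v *m W.
  rewrite !combE mul_scalar_mx mxE -scalemxAr -scalemxAl mulrC -scalerA -WY.
  by rewrite -scalerDr subrK.
have := expm_lincomb adW (const_mx 1).
rewrite (@expm_eigen _ _ _ t); last by rewrite mul_scalar_mx.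
by rewrite !combE !mxE scale1r mulr1 -scalemxAl.
Qed.

(** The index is shifted by 2 so that the constant and linear terms of an exponential series can be
    split off. *)
Lemma ncvg_bound m n (u : nat -> 'M[Cx R]_(m, n)) l c (b : R) :
  ncvg u l -> (forall k, nrm (u k.+2 - c) <= b) -> nrm (l - c) <= b.
Proof.
move=> ul ub.
have h : (fun k => nrm (u k - l) + b) @ \oo --> (0 + b : R).
  by apply: cvgD => //; exact: cvg_cst.
rewrite add0r in h; have hE := cvg_lim (@Rhausdorff R) h.
rewrite -hE; apply: limr_ge; first by apply/cvg_ex; exists b.
near=> k.
have -> : l - c = - (u k - l) + (u k - c) by rewrite opprB addrA subrK.
rewrite (le_trans (nrmD _ _)) // nrmN lerD2l.
have k2 : (2 <= k)%N by near: k; exists 2%N.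
by rewrite -(subnK k2) addn2.
Unshelve. all: by end_near. Qed.

Lemma series_exp_coeff_le (x : R) k : 0 <= x -> series (exp_coeff x) k <= expR x.
Proof.
move=> x0; apply: nondecreasing_cvgn_le; last exact: is_cvg_series_exp_coeff.
by apply: nondecreasing_series => j _ _; exact: exp_coeff_ge0.
Qed.

(** What remains starts with the quadratic term, and t^(j+2) <= t^2 on [0, 1]. The factor [nrm 1%:M]
    appears because this norm of the identity is the size of the matrix. *)
Lemma expm_order2 n (A : 'M[Cx R]_n) (t : R) : 0 <= t <= 1 ->
  nrm (expm (realC t *: A) - (1%:M + realC t *: A)) <=
    t ^+ 2 * (nrm (1%:M : 'M[Cx R]_n) * expR (nrm A)).
Proof.
move=> /andP[t0 t1]; apply: (ncvg_bound (expm_ncvg _)) => k.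
rewrite /series /= big_nat_recl // big_nat_recl // addrA.
have -> : expterm (realC t *: A) 0 = 1%:M.
  by rewrite /expterm fact0 invr1 scale1r expr0.
have -> : expterm (realC t *: A) 1 = realC t *: A.
  by rewrite /expterm factS fact0 muln1 invr1 scale1r expr1.
rewrite [X in nrm X]addrAC subrr add0r.
apply: (le_trans (nrm_sum _ _ _)).
apply: (@le_trans _ _ (\sum_(0 <= j < k)
    t ^+ 2 * (nrm (1%:M : 'M[Cx R]_n) * exp_coeff (nrm A) j.+2))).
  apply: ler_sum => j _; rewrite -[expterm _ _]mul1mx.
  apply: le_trans (nrm_mul_expterm _ _ _) _; rewrite [leRHS]mulrCA.
  rewrite ler_wpM2l ?nrm_ge0 // nrmZ cmod_realC ger0_norm //.
  rewrite /exp_coeff /= exprMn [leRHS]mulrA ler_wpM2r ?invr_ge0 //.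
  rewrite ler_wpM2r ?exprn_ge0 ?nrm_ge0 //.
  by rewrite -(addn2 j) exprD ler_piMl ?exprn_ge0 // exprn_ile1.
rewrite -mulr_sumr ler_wpM2l ?exprn_ge0 // -mulr_sumr ler_wpM2l ?nrm_ge0 //.
apply: le_trans (series_exp_coeff_le k.+2 (nrm_ge0 A)).
rewrite /series /= [leRHS]big_nat_recl // [X in _ + X]big_nat_recl // addrA.
by rewrite lerDr addr_ge0 // exp_coeff_ge0 ?nrm_ge0.
Qed.

(** Since exp(tA) = 1 + tA + O(t^2), equality along the ray bounds t |A - B| by a multiple of t^2,
    which fails for small t > 0 unless A = B. *)
Lemma expm_ray_inj n (A B : 'M[Cx R]_n) :
  (forall t : R, expm (realC t *: A) = expm (realC t *: B)) -> A = B.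
Proof.
move=> AB; apply/eqP; rewrite -subr_eq0; apply/eqP/nrm_eq0.
set c : R := nrm (1%:M : 'M[Cx R]_n) * expR (nrm A) +
  nrm (1%:M : 'M[Cx R]_n) * expR (nrm B).
have c0 : 0 <= c by rewrite addr_ge0 // mulr_ge0 ?nrm_ge0 ?expR_ge0.
rewrite leNgt; apply/negP; set x := nrm (A - B) => x0.
have bd t : 0 <= t <= 1 -> t * x <= t ^+ 2 * c.
  move=> t01; rewrite mulrDr.
  have -> : t * x = nrm (realC t *: A - realC t *: B).
    by rewrite -scalerBr nrmZ cmod_realC ger0_norm //; case/andP: t01.
  have -> : realC t *: A - realC t *: B =
      (expm (realC t *: B) - (1%:M + realC t *: B))
      - (expm (realC t *: A) - (1%:M + realC t *: A)).
    by rewrite AB opprB [RHS]addrC [RHS]addrA subrK opprD addrACA subrr add0r.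
  rewrite (le_trans (nrmD _ _)) // nrmN addrC.
  by apply: lerD; exact: expm_order2.
have y0 : 0 < x + c + 1 by rewrite ltr_wpDl // addr_ge0 // ltW.
(* Any t in (0, 1] with t c < x contradicts [bd]; this quotient also keeps the denominator
   positive. *)
pose t := x / (x + c + 1).
have t0 : 0 < t by rewrite divr_gt0.
have tE : t * (x + c + 1) = x by rewrite divfK // gt_eqF.
have t1 : t <= 1 by rewrite ler_pdivrMr // mul1r -addrA lerDl addr_ge0.
have := bd t; rewrite (ltW t0) t1 expr2 -mulrA ler_pM2l // => /(_ isT) h.
have tx := mulr_gt0 t0 x0.
by nra.
Qed.

(** Differentiates a relation between one-parameter groups at t = 0, by injectivity along rays. *)
Lemma expm_conj_ray n (k A B : 'M[Cx R]_n) : k \in unitmx ->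
  (forall t : R, k *m expm (realC t *: A) = expm (realC t *: B) *m k) ->
  k *m A = B *m k.
Proof.
move=> ku kAB; suff <- : k *m A *m invmx k = B by rewrite mulmxKV.
apply: expm_ray_inj => t.
have conj : k *m (realC t *: A) = (realC t *: (k *m A *m invmx k)) *m k.
  by rewrite -scalemxAl mulmxKV // scalemxAr.
by have := kAB t; rewrite (expm_conj conj) => /(can_inj (mulmxK ku)).
Qed.

Lemma ncvg_entry m n (u : nat -> 'M[Cx R]_(m, n)) l i j c :
  ncvg u l -> (forall k, u k.+1 i j = c) -> l i j = c.
Proof.
move=> ul uc.
(* The entry is wrapped in a 1 x 1 matrix in order to reuse uniqueness of limits. *)
have h1 : ncvg (fun k => (u k i j)%:M : 'M[Cx R]_1) (l i j)%:M.
  apply: ncvg_le ul => k; rewrite /nrm !big_ord1 !mxE !eqxx !mulr1n.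
  by have := nrm_entry (u k - l) i j; rewrite !mxE.
have h2 : ncvg (fun k => (u k i j)%:M : 'M[Cx R]_1) c%:M.
  rewrite /ncvg -cvg_shiftS; apply: cvg_near_cst; apply: nearW => k.
  by rewrite /= uc subrr nrm0.
have /matrixP /(_ 0 0) := ncvg_unique h1 h2.
by rewrite !mxE !eqxx !mulr1n.
Qed.

End ExponentialProperties.

(** * Unitriangular matrices and the adjoint relation *)

Section Unitriangular.
Context {R : realType} {d : nat}.
Variable ht : 'I_d -> R.

(** Off the diagonal, such a matrix only sends basis vectors to strictly greater height. Heights may
    coincide, and then the corresponding diagonal block is the identity. *)
Definition unitri (U : 'M[Cx R]_d) : Prop :=
  forall j k, ~~ (ht k < ht j) -> U j k = (j == k)%:R.

Definition strict_tri (S : 'M[Cx R]_d) : Prop :=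
  forall j k, ~~ (ht k < ht j) -> S j k = 0.

Lemma strict_triM S T : strict_tri S -> strict_tri T -> strict_tri (S *m T).
Proof.
move=> tS tT j k jk; rewrite mxE big1 // => l _.
case: (boolP (ht l < ht j)) => lj; last by rewrite tS // mul0r.
case: (boolP (ht k < ht l)) => kl; last by rewrite tT // mulr0.
by rewrite (lt_trans kl lj) in jk.
Qed.

Lemma unitriM U V : unitri U -> unitri V -> unitri (U *m V).
Proof.
have strict W : unitri W -> strict_tri (W - 1%:M).
  by move=> tW j k jk; rewrite !mxE tW // subrr.
move=> /strict tU /strict tV j k jk.
have -> : U *m V = (U - 1%:M) *m (V - 1%:M) + (U - 1%:M) + (V - 1%:M) + 1%:M.
  rewrite -{1}[U](subrK 1%:M) -{1}[V](subrK 1%:M).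
  by rewrite mulmxDl mulmxDr [1%:M *m _]mul1mx mulmx1 !addrA.
have := strict_triM tU tV jk; move: (tU j k jk) (tV j k jk).
rewrite !mxE => -> -> ->.
by rewrite !add0r.
Qed.

Lemma expm_unitri S : strict_tri S -> unitri (expm S).
Proof.
move=> tS j k jk; apply: (ncvg_entry (expm_ncvg S)) => m.
rewrite /series /= big_nat_recl // mxE summxE big1 ?addr0 => [|i _].
  by rewrite /expterm fact0 invr1 scale1r expr0 mxE.
rewrite mxE; suff -> : (S ^+ i.+1) j k = 0 by rewrite mulr0.
elim: i j k jk => [|i IH] j k jk; first by rewrite expr1 tS.
by rewrite exprS -mulmxE (strict_triM tS IH).
Qed.

(* Uniqueness of the LDL^T decomposition: column [l] of the product is
   [D l] times column [l] of [U] plus terms with columns of lower height. *)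
Lemma unitri_psd (U : 'M[Cx R]_d) (D : 'rV[Cx R]_d) :
  unitri U -> (forall l, D 0 l \is Num.real -> 0 < D 0 l) ->
  (forall j k, (U *m diag_mx D *m U^T) j k \is Num.real) ->
  forall x : 'cV[Cx R]_d, (forall j, x j 0 \is Num.real) ->
  0 <= (x^T *m (U *m diag_mx D *m U^T) *m x) 0 0.
Proof.
move=> tU Dpos Qreal.
have QE j k : (U *m diag_mx D *m U^T) j k = \sum_l U j l * D 0 l * U k l.
  rewrite mxE; apply: eq_bigr => l _; rewrite [U^T _ _]mxE mul_mx_diag.
  by rewrite mxE.
have key l : 0 < D 0 l /\ forall j, U j l \is Num.real.
  (* Induction on the number of indices of smaller height, whose columns are then known to be
     real. *)
  have [m] := ubnP #|[pred p | ht p < ht l]|.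
  elim: m l => [//|m IH] l lm.
  have prev p : ht p < ht l -> 0 < D 0 p /\ forall j, U j p \is Num.real.
    move=> pl; apply: IH; rewrite ltnS in lm; apply: leq_trans lm; apply: proper_card.
    apply/fintype.properP; split.
      by apply/fintype.subsetP => q; rewrite !inE => qp; exact: lt_trans pl.
    by exists p; rewrite !inE ?ltxx.
  have col j : U j l * D 0 l \is Num.real.
    have := Qreal j l; rewrite QE (bigD1 l) //= [U l l]tU ?ltxx // eqxx mulr1.
    rewrite rpredDr // rpred_sum // => p pl.
    case: (boolP (ht p < ht l)) => hpl.
      have [Dp Up] := prev p hpl.
      by rewrite rpredM // rpredM // gtr0_real.
    by rewrite [U l p]tU // eq_sym (negbTE pl) mulr0 rpred0.
  have Dl : 0 < D 0 l.
    by apply: Dpos; have := col l; rewrite [U l l]tU ?ltxx // eqxx mul1r.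
  split=> // j; have := col j.
  by rewrite fpredMr; [|exact: gtr0_real|rewrite gt_eqF].
(* In the real vector y = U^T x the form is the sum of the D_l y_l^2. *)
move=> x xreal; set y := U^T *m x.
have yE : x^T *m U = y^T by rewrite trmx_mul trmxK.
have -> : x^T *m (U *m diag_mx D *m U^T) *m x = (y^T *m diag_mx D) *m y.
  by rewrite -yE /y !mulmxA.
rewrite mxE; apply: sumr_ge0 => l _.
have yl : y l 0 \is Num.real.
  rewrite mxE rpred_sum // => j _.
  by rewrite mxE rpredM //; case: (key l).
have -> : (y^T *m diag_mx D) 0 l = y l 0 * D 0 l by rewrite mul_mx_diag !mxE.
rewrite mulrAC mulr_ge0 //.
  by rewrite -expr2 real_exprn_even_ge0.
by apply/ltW; case: (key l).
Qed.

End Unitriangular.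

(** Both [P] and its inverse are block diagonal for the height, so conjugation keeps U - 1 strictly
    triangular. *)
Lemma unitri_conj (R : realType) (d : nat) (ht : 'I_d -> R) (P U : 'M[Cx R]_d) :
  P \in unitmx ->
  (forall j k, P j k != 0 -> ht j = ht k) ->
  (forall j k, invmx P j k != 0 -> ht j = ht k) ->
  unitri ht U -> unitri ht (P *m U *m invmx P).
Proof.
move=> Pu Ph Pih tU j k jk.
have -> : P *m U *m invmx P = P *m (U - 1%:M) *m invmx P + 1%:M.
  by rewrite mulmxBr mulmx1 mulmxBl mulmxV // subrK.
rewrite mxE [X in _ + X]mxE mxE big1 ?add0r // => q _.
have [->|/Pih qk] := eqVneq (invmx P q k) 0; first by rewrite mulr0.
rewrite mxE big1 ?mul0r // => p _.
have [->|/Ph jp] := eqVneq (P j p) 0; first by rewrite mul0r.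
by rewrite !mxE tU ?subrr ?mulr0 // -jp qk.
Qed.

(** * Matrices of the adjoint action on a spanned subspace *)

Section AdjointRelation.
Context {R : realType} {d N : nat}.
Variable E : 'I_d -> 'M[Cx R]_N.
Hypothesis injE : forall v, lincomb E v = 0 -> v = 0.

(* [A] is the matrix of [Ad y] on the span of [E]. *)
Definition adrel (y : 'M[Cx R]_N) (A : 'M[Cx R]_d) : Prop :=
  y \in unitmx /\ forall v, y *m lincomb E v = lincomb E (A *m v) *m y.

Lemma adrel1 : adrel 1%:M 1%:M.
Proof. by split=> [|v]; rewrite ?unitmx1 // !mul1mx mulmx1. Qed.

Lemma adrelM y A z B : adrel y A -> adrel z B -> adrel (y *m z) (A *m B).
Proof.
move=> [yu yA] [zu zB]; split=> [|v]; first by rewrite unitmx_mul yu.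
by rewrite -mulmxA zB mulmxA yA -!mulmxA.
Qed.

Lemma adrel_uniq y A B : adrel y A -> adrel y B -> A = B.
Proof.
move=> [yu yA] [_ yB]; apply/matrixP => i j.
have : (A - B) *m delta_mx j 0 = 0 :> 'cV_d.
  apply: injE; apply: (can_inj (mulmxK yu)).
  by rewrite mul0mx mulmxBl lincombB mulmxBl -yA -yB subrr.
move=> /matrixP /(_ i 0); rewrite -colE !mxE => /eqP.
by rewrite subr_eq0 => /eqP.
Qed.

Lemma adrel_unit y A : adrel y A -> A \in unitmx.
Proof.
move=> [yu yA]; rewrite -unitmx_tr -row_free_unit; apply: inj_row_free => v vA.
have Av : A *m v^T = 0 by rewrite -[A]trmxK -trmx_mul vA trmx0.
have : lincomb E v^T = 0.
  apply: (can_inj (mulKmx yu)); rewrite yA Av mulmx0.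
  by rewrite /lincomb big1 ?mul0mx // => k _; rewrite mxE scale0r.
by move=> /injE /(congr1 trmx); rewrite trmxK trmx0.
Qed.

Lemma adrelV y A : adrel y A -> adrel (invmx y) (invmx A).
Proof.
move=> yA; have Au := adrel_unit yA; case: yA => yu yA.
split=> [|v]; first by rewrite unitmx_inv.
apply: (can_inj (mulKmx yu)); rewrite mulmxA mulmxV // mul1mx.
by rewrite mulmxA yA mulmxA mulmxV // mul1mx mulmxK.
Qed.

Lemma adrel_expm W S :
  (forall v, W *m lincomb E v = lincomb E (S *m v) + lincomb E v *m W) ->
  expm W \in unitmx -> adrel (expm W) (expm S).
Proof. by move=> WS Wu; split=> // v; exact: expm_lincomb. Qed.

End AdjointRelation.

(** * Orthogonal eigenbases of commuting symmetric operators *)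

Lemma linfunE (K : fieldType) (V W : vectType K) (f : V -> W) :
  linear f -> linfun f =1 f.
Proof.
move=> flin.
pose l : {linear V -> W} := HB.pack_for {linear V -> W} f
  (GRing.isLinear.Build K V W *:%R f flin).
exact: (lfunE l).
Qed.

Section SymmetricFamily.
Context {R : realType} {V : vectType R}.
Variable b : V -> V -> R.
Hypothesis b_lin : forall c x y z, b (c *: x + y) z = c * b x z + b y z.
Hypothesis bC : forall x y, b x y = b y x.
Hypothesis b_pos : forall x, x != 0 -> 0 < b x x.

Lemma formDl x y z : b (x + y) z = b x z + b y z.
Proof. by rewrite -[x]scale1r b_lin mul1r scale1r. Qed.

Lemma form0l z : b 0 z = 0.
Proof. by apply: (addrI (b 0 z)); rewrite -formDl !addr0. Qed.

Lemma formZl c x z : b (c *: x) z = c * b x z.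
Proof. by rewrite -[c *: x]addr0 b_lin form0l addr0. Qed.

Lemma formZr c x z : b x (c *: z) = c * b x z.
Proof. by rewrite bC formZl bC. Qed.

Lemma formDr x y z : b x (y + z) = b x y + b x z.
Proof. by rewrite bC formDl !(bC x). Qed.

Lemma formNl x z : b (- x) z = - b x z.
Proof. by rewrite -scaleN1r formZl mulN1r. Qed.

Lemma form_ge0 x : 0 <= b x x.
Proof. by have [->|/b_pos/ltW//] := eqVneq x 0; rewrite form0l. Qed.

Definition symmetric_op (f : 'End(V)) := forall x y, b (f x) y = b x (f y).

Lemma form_linear_for x : linear_for *%R (b x : V -> R).
Proof. by move=> c y z; rewrite formDr formZr. Qed.

(* A complex eigenvalue p + iq with eigenvector x + iy satisfies
   q (b x x + b y y) = 0. *)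
Lemma symmetric_eigenvector (f : 'End(V)) (U : {vspace V}) :
  symmetric_op f -> (f @: U <= U)%VS -> U != 0%VS ->
  exists c v, [/\ v \in U, v != 0 & f v = c *: v].
Proof.
move=> fsym fU U0; set m := \dim U; pose u := vbasis U.
have m0 : (0 < m)%N by rewrite lt0n dimv_eq0.
have uU i : u`_i \in U.
  by have [im|im] := ltnP i m; [rewrite vbasis_mem // mem_nth ?size_tuple
    |rewrite nth_default ?mem0v // size_tuple].
pose A : 'M[R]_m := \matrix_(i, j) coord u j (f u`_i).
have fu (i : 'I_m) : f u`_i = \sum_j A i j *: u`_j.
  have : f u`_i \in U by apply: (subvP fU); rewrite memv_img.
  by move/coord_vbasis => {1}->; apply: eq_bigr => j _; rewrite mxE.
pose comb (x : 'rV[R]_m) := \sum_i x 0 i *: u`_i.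
have combU x : comb x \in U by apply: memv_suml => i _; rewrite memvZ.
have fcomb x : f (comb x) = comb (x *m A).
  rewrite /comb linear_sum /=.
  under eq_bigr => i _ do rewrite linearZ /= fu scaler_sumr.
  rewrite exchange_big /=; apply: eq_bigr => j _.
  by rewrite mxE scaler_suml; apply: eq_bigr => i _; rewrite scalerA.
have comb_eq0 x : comb x = 0 -> x = 0.
  move=> x0; apply/rowP => i; rewrite mxE.
  by have /freeP := basis_free (vbasisP U); apply.
(* Over the complex numbers an eigenvector exists; its real and imaginary parts span a plane or line
   stable under [f]. *)
have [a /eigenvalueP[w wA w0]] := eigenvalue_closed (map_mx (@realC R) A) m0.
pose x : 'rV[R]_m := \row_i complex.Re (w 0 i).
pose y : 'rV[R]_m := \row_i complex.Im (w 0 i).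
pose p := complex.Re a; pose q := complex.Im a.
have ReIm i : complex.Re (w 0 i) = x 0 i /\ complex.Im (w 0 i) = y 0 i.
  by rewrite !mxE.
have mulE (z1 z2 : Cx R) :
    (complex.Re (z1 * z2) = complex.Re z1 * complex.Re z2 - complex.Im z1 * complex.Im z2)
    * (complex.Im (z1 * z2) = complex.Re z1 * complex.Im z2 + complex.Im z1 * complex.Re z2).
  by case: z1 z2 => [? ?] [].
have xA : x *m A = p *: x - q *: y.
  apply/rowP => j; have /rowP /(_ j) /(congr1 (@complex.Re R)) := wA.
  rewrite [_ j in LHS]mxE [(a *: w) _ _]mxE mulE.
  rewrite (big_morph (@complex.Re R) (@ReD R) erefl) !mxE => <-.
  by apply: eq_bigr => k _; rewrite !mxE mulE /= mulr0 subr0.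
have yA : y *m A = p *: y + q *: x.
  apply/rowP => j; have /rowP /(_ j) /(congr1 (@complex.Im R)) := wA.
  rewrite [_ j in LHS]mxE [(a *: w) _ _]mxE mulE.
  rewrite (big_morph (@complex.Im R) (@ImD R) erefl) !mxE => <-.
  by apply: eq_bigr => k _; rewrite !mxE mulE /= mulr0 add0r.
have combL c1 c2 z1 z2 : comb (c1 *: z1 + c2 *: z2) = c1 *: comb z1 + c2 *: comb z2.
  rewrite /comb !scaler_sumr -big_split /=; apply: eq_bigr => i _.
  by rewrite !mxE scalerDl !scalerA.
have fX : f (comb x) = p *: comb x + (- q) *: comb y.
  by rewrite fcomb xA -combL scaleNr.
have fY : f (comb y) = p *: comb y + q *: comb x by rewrite fcomb yA combL.
have q0 : q = 0.
  have := fsym (comb x) (comb y); rewrite fX fY formDl formDr !formZl !formZr.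
  rewrite mulNr => /addrI h.
  have /eqP : q * (b (comb x) (comb x) + b (comb y) (comb y)) = 0.
    by rewrite mulrDr -h addNr.
  rewrite mulf_eq0 => /orP[/eqP //|].
  rewrite paddr_eq0 ?form_ge0 // => /andP[hx hy].
  have z0 z : b (comb z) (comb z) == 0 -> z = 0.
    move=> h0; apply: comb_eq0; apply: contraTeq h0 => /b_pos.
    by rewrite lt0r => /andP[].
  have x0 := z0 _ hx; have y0 := z0 _ hy.
  case/eqP: w0; apply/rowP => i; apply/eqP; rewrite eq_complex mxE.
  by case: (ReIm i) => -> ->; rewrite x0 y0 !mxE /= !eqxx.
have [x0|x0] := eqVneq x 0.
  have y0 : y != 0.
    apply: contra w0 => /eqP y0; apply/eqP/rowP => i; apply/eqP.
    by rewrite eq_complex mxE; case: (ReIm i) => -> ->; rewrite x0 y0 !mxE /= !eqxx.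
  exists p, (comb y); split=> //; first by apply: contra y0 => /eqP/comb_eq0 ->.
  by rewrite fY q0 scale0r addr0.
exists p, (comb x); split=> //; first by apply: contra x0 => /eqP/comb_eq0 ->.
by rewrite fX q0 oppr0 scale0r addr0.
Qed.

Variable F : 'End(V) -> Prop.
Hypothesis F_sym : forall f, F f -> symmetric_op f.
Hypothesis F_comm : forall f f' x, F f -> F f' -> f (f' x) = f' (f x).

Definition common_eigenvector v := forall f, F f -> exists c, f v = c *: v.

(** If some operator is not scalar on [U], one of its eigenspaces in [U] is nonzero, strictly
    smaller, and stable under the commuting family; the dimension decreases. Otherwise any nonzero
    vector works. *)
Lemma exists_common_eigenvector (U : {vspace V}) :
  (forall f, F f -> (f @: U <= U)%VS) -> U != 0%VS ->
  exists v, [/\ v \in U, v != 0 & common_eigenvector v].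
Proof.
have [m] := ubnP (\dim U); elim: m U => [//|m IH] U Um FU U0.
have [allc|] := pselect (forall f, F f -> exists c, forall v, v \in U -> f v = c *: v).
  exists (vpick U); split; [exact: memv_pick|by rewrite vpick0|].
  by move=> f /allc[c fc]; exists c; apply: fc; exact: memv_pick.
move=> /existsNP[f /not_implyP[Ff nc]].
have [c [v [vU v0 fv]]] := symmetric_eigenvector (F_sym Ff) (FU f Ff) U0.
pose U' := (U :&: lker (f - c *: \1%VF))%VS.
have U'P x : (x \in U') = (x \in U) && (f x == c *: x).
  rewrite memv_cap memv_ker add_lfunE opp_lfunE scale_lfunE id_lfunE.
  by rewrite subr_eq0.
have sU : (U' <= U)%VS by exact: capvSl.
have ltU : (\dim U' < \dim U)%N.
  rewrite ltn_neqAle dimvS // andbT; apply: contra_not_neq nc => eqd.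
  have U'E : U' = U by apply/eqP; rewrite eqEdim sU eqd leqnn.
  exists c => x xU; apply/eqP.
  by move: (xU); rewrite -{1}U'E U'P => /andP[].
have U'0 : U' != 0%VS.
  by apply/eqP => h; have : v \in U' by [rewrite U'P vU fv eqxx]; rewrite h memv0 (negbTE v0).
have FU' f' : F f' -> (f' @: U' <= U')%VS.
  move=> Ff'; apply/subvP => z /memv_imgP[x]; rewrite U'P => /andP[xU /eqP fx] ->.
  rewrite U'P (subvP (FU f' Ff')) ?memv_img //=.
  by rewrite F_comm // fx linearZ.
have [w [wU' w0 ew]] := IH U' (leq_trans ltU Um) FU' U'0.
by exists w; split=> //; exact: (subvP sU).
Qed.

(** A common eigenvector is split off; by symmetry its orthogonal complement in [U] is again stable
    under the family. *)
Lemma orthogonal_eigenbasis_of (U : {vspace V}) :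
  (forall f, F f -> (f @: U <= U)%VS) ->
  exists s : seq V,
  [/\ forall v, v \in s -> [/\ v \in U, v != 0 & common_eigenvector v],
      pairwise (fun v w => b v w == 0) s
    & forall x, x \in U -> x = \sum_(v <- s) (b x v / b v v) *: v].
Proof.
have [m] := ubnP (\dim U); elim: m U => [//|m IH] U Um FU.
have [U0|U0] := eqVneq U 0%VS.
  exists [::]; split=> // x; rewrite U0 memv0 => /eqP ->.
  by rewrite big_nil.
have [v [vU v0 ev]] := exists_common_eigenvector FU U0.
pose phi : 'Hom(V, R^o) := linfun (b v).
have phiE x : phi x = b v x.
  by rewrite linfunE // => c y z; exact: form_linear_for.
pose U' := (U :&: lker phi)%VS.
have U'P x : (x \in U') = (x \in U) && (b v x == 0).
  by rewrite memv_cap memv_ker phiE.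
have sU : (U' <= U)%VS by exact: capvSl.
have bvv : b v v != 0 by rewrite gt_eqF // b_pos.
have ltU : (\dim U' < \dim U)%N.
  rewrite ltn_neqAle dimvS // andbT; apply/eqP => eqd.
  have U'E : U' = U by apply/eqP; rewrite eqEdim sU eqd leqnn.
  by move: vU; rewrite -U'E U'P (negbTE bvv) andbF.
have FU' f : F f -> (f @: U' <= U')%VS.
  move=> Ff; apply/subvP => z /memv_imgP[x]; rewrite U'P => /andP[xU /eqP vx] ->.
  rewrite U'P (subvP (FU f Ff)) ?memv_img //= -(F_sym Ff).
  by have [c ->] := ev f Ff; rewrite formZl vx mulr0.
have [s [sP sorth sx]] := IH U' (leq_trans ltU Um) FU'.
exists (v :: s); split.
- move=> w; rewrite inE => /predU1P[-> //|/sP[wU' w0 ew]].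
  by split=> //; exact: (subvP sU).
- rewrite /= sorth andbT; apply/allP => w /sP[].
  by rewrite U'P => /andP[].
- move=> x xU; rewrite big_cons.
  have xU' : x - (b x v / b v v) *: v \in U'.
    rewrite U'P rpredB ?memvZ //= bC formDl formNl formZl divfK // subrr.
    exact: eqxx.
  rewrite -[LHS](subrK ((b x v / b v v) *: v)) addrC; congr (_ + _).
  rewrite (sx _ xU'); apply: eq_big_seq => w /sP[]; rewrite U'P => /andP[_ /eqP vw] _ _.
  by rewrite formDl formNl formZl vw mulr0 subr0.
Qed.

Lemma orthogonal_eigenbasis :
  exists s : seq V,
  [/\ forall v, v \in s -> v != 0 /\ common_eigenvector v,
      pairwise (fun v w => b v w == 0) s
    & forall x, x = \sum_(v <- s) (b x v / b v v) *: v].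
Proof.
have [|s [sP so sx]] := @orthogonal_eigenbasis_of fullv.
  by move=> f _; exact: subvf.
by exists s; split=> [v /sP[]|//|x] //; apply: sx; exact: memvf.
Qed.

End SymmetricFamily.

(** * The Killing form and restricted roots *)

Section LieTheory.
Context {R : realType} {g : lieAlgebra R}.
Implicit Types X Y W H : g.

Lemma lieDl X Y W : lie (X + Y) W = lie X W + lie Y W.
Proof. by have := lie_linearl 1 X Y W; rewrite !scale1r. Qed.

Lemma lieDr X Y W : lie W (X + Y) = lie W X + lie W Y.
Proof. by have := lie_linearr 1 X Y W; rewrite !scale1r. Qed.

Lemma lie0r X : lie X 0 = 0.
Proof. by apply: (addrI (lie X 0)); rewrite -lieDr !addr0. Qed.

Lemma lie0l X : lie 0 X = 0.
Proof. by apply: (addrI (lie 0 X)); rewrite -lieDl !addr0. Qed.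

Lemma lieZl c X Y : lie (c *: X) Y = c *: lie X Y.
Proof. by rewrite -[c *: X]addr0 lie_linearl lie0l addr0. Qed.

Lemma lieZr c X Y : lie X (c *: Y) = c *: lie X Y.
Proof. by rewrite -[c *: Y]addr0 lie_linearr lie0r addr0. Qed.

Lemma lieNl X Y : lie (- X) Y = - lie X Y.
Proof. by rewrite -scaleN1r lieZl scaleN1r. Qed.

Lemma lieNr X Y : lie X (- Y) = - lie X Y.
Proof. by rewrite -scaleN1r lieZr scaleN1r. Qed.

Lemma lieC X Y : lie X Y = - lie Y X.
Proof.
apply/eqP; rewrite -addr_eq0; have := lie_alt (X + Y).
by rewrite lieDl !lieDr !lie_alt add0r addr0 => ->.
Qed.

Lemma lie_suml (I : Type) (r : seq I) (F : I -> g) Y :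
  lie (\sum_(i <- r) F i) Y = \sum_(i <- r) lie (F i) Y.
Proof. by apply: (big_morph (lie^~ Y) (fun X W => lieDl X W Y)); rewrite lie0l. Qed.

Lemma lie_sumr (I : Type) (r : seq I) (F : I -> g) Y :
  lie Y (\sum_(i <- r) F i) = \sum_(i <- r) lie Y (F i).
Proof. by apply: (big_morph (lie Y) (fun X W => lieDr X W Y)); rewrite lie0r. Qed.

Lemma lie_jacobil X Y W : lie (lie X Y) W = lie X (lie Y W) - lie Y (lie X W).
Proof.
have := lie_jacobi X Y W; rewrite (lieC W (lie X Y)) => /eqP.
by rewrite subr_eq0 => /eqP <-; rewrite (lieC W X) lieNr.
Qed.

Lemma lie_jacobir X Y W : lie X (lie Y W) = lie (lie X Y) W + lie Y (lie X W).
Proof. by rewrite lie_jacobil subrK. Qed.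

Lemma lie_linear X : linear (lie X).
Proof. by move=> c Y W; rewrite lie_linearr. Qed.

Lemma trace_comp (f h : g -> g) : linear f -> linear h ->
  trace (f \o h) = trace (h \o f).
Proof.
have expand (f1 f2 : g -> g) : linear f1 -> trace (f1 \o f2) =
    \sum_(i < \dim {:g}) \sum_(j < \dim {:g}) coord (vbasis {:g}) j (f2 (vbasis {:g})`_i) *
                  coord (vbasis {:g}) i (f1 (vbasis {:g})`_j).
  move=> lf1; rewrite /trace; apply: eq_bigr => i _ /=.
  rewrite {1}(coord_vbasis (memvf (f2 (vbasis {:g})`_i))) -(linfunE lf1).
  rewrite !linear_sum /=; apply: eq_bigr => j _.
  by rewrite !linearZ /= linfunE.
move=> lf lh; rewrite !expand // exchange_big /=.
by apply: eq_bigr => i _; apply: eq_bigr => j _; rewrite mulrC.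
Qed.

Lemma eq_trace (f h : g -> g) : f =1 h -> trace f = trace h.
Proof. by move=> /funext ->. Qed.

Lemma traceB (f h : g -> g) : trace (fun X => f X - h X) = trace f - trace h.
Proof. by rewrite /trace -sumrB; apply: eq_bigr => i _; rewrite raddfB. Qed.

Lemma traceDZ c (f h : g -> g) :
  trace (fun X => c *: f X + h X) = c * trace f + trace h.
Proof.
rewrite /trace mulr_sumr -big_split; apply: eq_bigr => i _.
exact: linearP.
Qed.

Lemma linear_comp (f h : g -> g) : linear f -> linear h -> linear (f \o h).
Proof. by move=> lf lh c X Y /=; rewrite lh lf. Qed.

Lemma killingC X Y : killing X Y = killing Y X.
Proof. exact: (trace_comp (lie_linear X) (lie_linear Y)). Qed.

Lemma killing_linear c X Y W : killing (c *: X + Y) W = c * killing X W + killing Y W.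
Proof.
by rewrite /killing -traceDZ; apply: eq_trace => V; rewrite lie_linearl.
Qed.

(** Once both brackets are expanded by the Jacobi identity, the traces differ only by a cyclic
    permutation of ad X, ad Y, ad W. *)
Lemma killing_invariant X Y W : killing (lie X Y) W = killing X (lie Y W).
Proof.
rewrite /killing.
rewrite (eq_trace (h := fun V => lie X (lie Y (lie W V)) - lie Y (lie X (lie W V)))).
  rewrite [RHS](eq_trace (h := fun V =>
    lie X (lie Y (lie W V)) - lie X (lie W (lie Y V)))).
    rewrite !traceB; congr (_ - _).
    apply: (@trace_comp (lie Y) (lie X \o lie W) (lie_linear Y)).
    exact: linear_comp (lie_linear X) (lie_linear W).
  by move=> V; rewrite (lie_jacobil Y W V) lieDr lieNr.
by move=> V; rewrite lie_jacobil.
Qed.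

Variable theta : 'End(g).
Hypothesis htheta : cartan_involution theta.

Lemma thetaK X : theta (theta X) = X. Proof. by case: htheta. Qed.

Lemma theta_lie X Y : theta (lie X Y) = lie (theta X) (theta Y).
Proof. by case: htheta. Qed.

(** As [theta] is an involutive automorphism, ad (theta X) is the conjugate of ad X by [theta]. *)
Lemma killing_theta X Y : killing (theta X) (theta Y) = killing X Y.
Proof.
rewrite /killing (eq_trace (h := theta \o ((fun W => lie X (lie Y W)) \o theta))).
  have lXY : linear (fun W => lie X (lie Y W)).
    exact: linear_comp (lie_linear X) (lie_linear Y).
  rewrite trace_comp; first by apply: eq_trace => W /=; rewrite thetaK.
  - exact: linearP.
  - by apply: linear_comp => //; exact: linearP.
by move=> W /=; rewrite !theta_lie thetaK.
Qed.

Definition cartan_form X Y : R := - killing X (theta Y).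

Lemma cartan_form_linear c X Y W :
  cartan_form (c *: X + Y) W = c * cartan_form X W + cartan_form Y W.
Proof. by rewrite /cartan_form killing_linear opprD mulrN. Qed.

Lemma cartan_formC X Y : cartan_form X Y = cartan_form Y X.
Proof. by rewrite /cartan_form -killing_theta thetaK killingC. Qed.

Lemma cartan_form_pos X : X != 0 -> 0 < cartan_form X X.
Proof. by case: htheta => _ _; apply. Qed.

(** Follows from invariance of the Killing form. On [a], where [theta] is -1, it makes every ad H
    symmetric. *)
Lemma cartan_form_adjoint X Y W :
  cartan_form (lie X Y) W = - cartan_form Y (lie (theta X) W).
Proof.
rewrite /cartan_form theta_lie thetaK opprK lieC.
by rewrite (formNl killing_linear) opprK killing_invariant.
Qed.

Lemma pspaceP X : reflect (theta X = - X) (X \in pspace theta).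
Proof.
rewrite /pspace memv_ker add_lfunE id_lfunE addr_eq0.
exact: eqP.
Qed.

Variable a : {vspace g}.
Hypothesis ha : maximal_abelian_in (pspace theta) a.

Lemma theta_a H : H \in a -> theta H = - H.
Proof. by case: ha => /subvP ap _ _ /ap /pspaceP. Qed.

(** Maximality of [a] is applied to the abelian subspace spanned by [a] and [X]. *)
Lemma centralizer_in_a X :
  theta X = - X -> (forall H, H \in a -> lie H X = 0) -> X \in a.
Proof.
case: ha => ap ab amax tX HX.
have bE : (a + <[X]>)%VS = a.
  apply: amax; first exact: addvSl.
    rewrite subv_add ap /=; apply/subvP => Y /vlineP[c ->].
    by apply/pspaceP; rewrite linearZ /= tX scalerN.
  move=> Y1 Y2 /memv_addP[H1 h1 [_ /vlineP[c1 ->] ->]].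
  move=> /memv_addP[H2 h2 [_ /vlineP[c2 ->] ->]].
  rewrite lieDl !lieDr !lieZl !lieZr ab // lie_alt HX // (lieC X H2) HX //.
  by rewrite oppr0 !scaler0 !addr0.
by rewrite -bE memvE addvSr.
Qed.

Lemma root_space_theta (al : dual_space a) X :
  root_space al X -> root_space (- al) (theta X).
Proof.
move=> rX H; rewrite opp_lfunE scaleNr.
have tH := theta_a (subvsP H).
rewrite -[vsval H]opprK -tH lieNl -theta_lie rX.
by rewrite linearZ.
Qed.

Lemma restricted_rootN (al : dual_space a) :
  restricted_root al -> restricted_root (- al).
Proof.
move=> [al0 [X rX X0]]; split; first by rewrite oppr_eq0.
exists (theta X); first exact: root_space_theta.
by apply: contra X0 => /eqP tX; rewrite -[X]thetaK tX linear0.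
Qed.

Lemma root_space_lie (al ga : dual_space a) X Y :
  root_space al X -> root_space ga Y -> root_space (al + ga) (lie X Y).
Proof.
move=> rX rY H; rewrite lie_jacobir rX rY lieZl lieZr -scalerDl.
by rewrite add_lfunE.
Qed.

(** The bracket is negated by [theta] and has weight 0, so it lies in [a]. There it is a positive
    multiple of the Killing dual of [ga], as is [T], and the Killing form is positive definite on
    [a]. *)
Lemma root_bracket (ga : dual_space a) (X : g) (T : subvs_of a) :
  ga != 0 -> X != 0 -> root_space ga X -> coroot ga T ->
  exists2 c, 0 < c & lie (theta X) X = c *: vsval T.
Proof.
move=> ga0 X0 rX [gaT Torth].
have killH H : H \in a -> H != 0 -> 0 < killing H H.
  move=> Ha H0; have := cartan_form_pos H0.
  by rewrite /cartan_form theta_a // killingC (formNl killing_linear) opprK.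
have T0 : vsval T != 0.
  apply/eqP => T0; have T00 : T = 0 by apply: subvs_inj; rewrite T0 linear0.
  by move: gaT; rewrite T00 linear0 => /eqP; rewrite eq_sym pnatr_eq0.
have TT := killH _ (subvsP T) T0.
set v := lie (theta X) X.
have va : v \in a.
  apply: centralizer_in_a => [|H Ha].
    by rewrite /v theta_lie thetaK lieC.
  have rtX := root_space_theta rX.
  have := root_space_lie rtX rX (Sub H Ha).
  by rewrite addNr zero_lfunE scale0r.
have XX := cartan_form_pos X0.
have kv (H : subvs_of a) : killing v (vsval H) = ga H * cartan_form X X.
  rewrite /v killing_invariant (lieC X) rX -scaleNr killingC.
  by rewrite (formZl killing_linear) /cartan_form mulrN mulNr.
(* The constant is forced by pairing both sides with [T], where [ga T = 2]. *)
pose c := 2 * cartan_form X X / killing (vsval T) (vsval T).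
have c0 : 0 < c by rewrite divr_gt0 // mulr_gt0.
exists c => //; apply/eqP; rewrite -subr_eq0; apply/eqP.
set w := v - c *: vsval T.
have wa : w \in a by rewrite rpredB // memvZ // subvsP.
have kw (H : subvs_of a) : killing w (vsval H) = 0.
  rewrite /w addrC -scaleNr killing_linear kv.
  pose H' := H - (ga H / 2) *: T.
  have gaH' : ga H' = 0.
    by rewrite /H' linearB linearZ /= gaT /GRing.scale /= divfK ?subrr // pnatr_eq0.
  have HE : vsval H = (ga H / 2) *: vsval T + vsval H'.
    by rewrite /H' linearB linearZ /= [RHS]addrC scalerN subrK.
  rewrite {1}HE killingC killing_linear (killingC (vsval H')) (Torth H') // addr0.
  by rewrite /c; field; rewrite gt_eqF.
apply/eqP; apply: contraT => w0; have := killH _ wa w0.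
by rewrite (kw (Sub w wa)) ltxx.
Qed.

End LieTheory.

(** * Weight bases and the values of roots on the Weyl polytope *)

Section RootValues.
Context {R : realType} {g : lieAlgebra R}.
Variables (theta : 'End(g)) (a : {vspace g}).
Hypothesis htheta : cartan_involution theta.
Hypothesis ha : maximal_abelian_in (pspace theta) a.

(** The weight 0 is allowed, so that the centralizer of [a] is covered too. *)
Definition weight_vector (x : g) := exists al : dual_space a, root_space al x.

(** The operators ad H with H in [a] commute and are symmetric for the positive definite
    [cartan_form]. *)
Lemma exists_weight_basis :
  exists s : seq g,
  [/\ forall v, v \in s -> v != 0 /\ weight_vector v,
      pairwise (fun v w => cartan_form theta v w == 0) s
    & forall x, x = \sum_(v <- s)
        (cartan_form theta x v / cartan_form theta v v) *: v].
Proof.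
have blin := @cartan_form_linear R g theta.
have bC := cartan_formC htheta.
have bpos := cartan_form_pos htheta.
pose F (f : 'End(g)) := exists2 H, H \in a & f = linfun (lie H).
have FE f : F f -> exists2 H, H \in a & f =1 lie H.
  by move=> [H Ha ->]; exists H => // x; rewrite linfunE //; exact: lie_linear.
have Fsym f : F f -> symmetric_op (cartan_form theta) f.
  move=> /FE[H Ha fE] x y; rewrite !fE (cartan_form_adjoint htheta).
  by rewrite (theta_a ha) // lieNl (bC x (- _)) (formNl blin) opprK bC.
have Fcomm f f' x : F f -> F f' -> f (f' x) = f' (f x).
  move=> /FE[H Ha fE] /FE[H' Ha' fE']; rewrite !fE !fE' lie_jacobir.
  by case: ha => _ ab _; rewrite (ab H H') // lie0l add0r.
have [s [sP so sx]] := orthogonal_eigenbasis blin bC bpos Fsym Fcomm.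
exists s; split=> // v vs; have [v0 ev] := sP v vs; split=> //.
have vv : cartan_form theta v v != 0 by rewrite gt_eqF // bpos.
(* The eigenvalue is written as a Rayleigh quotient, which is visibly linear in H. *)
pose al (H : subvs_of a) : R^o := cartan_form theta (lie (vsval H) v) v / cartan_form theta v v.
have al_lin : linear al.
  move=> c H1 H2; rewrite /al linearD linearZ /= lie_linearl blin mulrDl.
  by rewrite -mulrA.
exists (linfun al) => H; rewrite linfunE // /al.
have [|c] := ev (linfun (lie (vsval H))).
  by exists (vsval H) => //; exact: subvsP.
rewrite linfunE; last exact: lie_linear.
by move=> ->; rewrite (formZl blin) mulfK.
Qed.

Variables (n : nat) (Pi : n.-tuple (dual_space a)) (i0 : 'I_n).
Variables (Z : subvs_of a) (be : dual_space a).
Hypothesis hPi : root_basis Pi.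
Hypothesis hZ : forall i, tnth Pi i Z = (i == i0)%:R.
Hypothesis hbe : highest_root Pi be.
Hypothesis hi0 : coord Pi i0 be = 1.

Lemma sum_simple_Z (c : 'I_n -> R) : (\sum_i c i *: tnth Pi i) Z = c i0.
Proof.
rewrite sum_lfunE (bigD1 i0) //= scale_lfunE hZ eqxx big1 => [|i ii0].
  by rewrite addr0 /GRing.scale /= mulr1.
by rewrite scale_lfunE hZ (negbTE ii0) /GRing.scale /= mulr0.
Qed.

Lemma highest_root_Z : be Z = 1.
Proof.
case: hPi => Pbasis _ _.
have beE : be = \sum_i coord Pi i be *: tnth Pi i.
  rewrite {1}(coord_basis Pbasis (memvf be)).
  by apply: eq_bigr => i _; rewrite (tnth_nth 0).
by rewrite {1}beE (sum_simple_Z (fun i => coord Pi i be)) hi0.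
Qed.

(** Subtracting [ga] or [- ga] from the highest root leaves natural coefficients, so ga(Z) = 1 - k
    and -ga(Z) = 1 - l with k + l = 2. *)
Lemma root_Z ga : restricted_root ga -> [\/ ga Z = -1, ga Z = 0 | ga Z = 1].
Proof.
move=> rga; case: (hbe) => _ hmax.
have val al : restricted_root al -> exists k : nat, al Z = 1 - k%:R.
  move=> /hmax[c cE]; exists (c i0).
  have : (be - al) Z = (c i0)%:R by rewrite cE (sum_simple_Z (fun i => (c i)%:R)).
  by rewrite add_lfunE opp_lfunE highest_root_Z => <-; rewrite opprB addrC subrK.
have [k kE] := val _ rga.
have [l] := val _ (restricted_rootN htheta ha rga).
rewrite opp_lfunE kE => lE.
have kl : (k + l = 2)%N.
  by apply/eqP; rewrite -(eqr_nat R) natrD; apply/eqP; lra.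
case: k kl kE {lE} => [|[|[|//]]] kl kE.
- by constructor 3; rewrite subr0.
- by constructor 2; rewrite subrr.
- by constructor 1; lra.
Qed.

Lemma root_Z_le1 ga : restricted_root ga -> `|ga Z : R| <= 1.
Proof. by move=> /root_Z[] ->; rewrite ?normrN ?normr1 ?normr0 ?ler01. Qed.

Hypothesis reflection_root : forall al ga T,
  restricted_root al -> restricted_root ga -> coroot ga T ->
  restricted_root (al - (al T : R) *: ga : dual_space a).

(** The outermost reflection is moved from the vector to the root; hence the induction on the word
    keeps [al] arbitrary. *)
Lemma weyl_bound (w : subvs_of a -> subvs_of a) (r : R) al : 0 <= r ->
  weyl_group w -> restricted_root al -> `|al (w (r *: Z)) : R| <= r.
Proof.
move=> r0 Ww; elim: Ww al => [|w' ga T rga cT Ww' IH] al ral.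
  by rewrite linearZ /= normrM ger0_norm // ler_piMr // root_Z_le1.
apply: le_trans (IH _ (reflection_root ral rga cT)).
rewrite add_lfunE opp_lfunE scale_lfunE raddfB /=.
have -> : al (ga (w' (r *: Z)) *: T) = (ga (w' (r *: Z)) : R) *: al T.
  by rewrite linearZ.
by rewrite /GRing.scale /= mulrC.
Qed.

(** The strip where |al| <= r is convex and contains the Weyl orbit, hence its hull. From an
    interior point one can still move both ways along a direction where [al] is 1, so the bound is
    strict. *)
Lemma Omega_bound (r : R) (X : subvs_of a) al : 0 <= r ->
  OmegaH (r *: Z) X -> restricted_root al -> `|al X : R| < r.
Proof.
move=> r0 XO ral.
pose C : set (subvs_of a) := [set H | `|al H : R| <= r].
have hullC : convex_hull (weyl_orbit (r *: Z)) `<=` C.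
  apply: smallest_sub; last by move=> _ [w Ww <-]; exact: weyl_bound.
  move=> x y k; rewrite !inE /C /= => xC yC.
  have k0 : 0 <= k%:num by [].
  have k1 : k%:num <= 1 by [].
  (* Exposes the affine combination behind the abstract convex structure. *)
  change (`|al ((k%:num : R) *: (x : subvs_of a) + (1 - k%:num) *: (y : subvs_of a)) : R| <= r).
  move: (k%:num : R) k0 k1 => t t0 t1.
  have -> : al (t *: (x : subvs_of a) + (1 - t) *: (y : subvs_of a)) =
      t * (al x : R) + (1 - t) * (al y : R) :> R by rewrite linearD !linearZ.
  apply: (le_trans (ler_normD _ _)); rewrite !normrM.
  rewrite (ger0_norm t0) (@ger0_norm _ (1 - t)) ?subr_ge0 //.
  apply: (@le_trans _ _ (t * r + (1 - t) * r)).
    by rewrite lerD // ler_wpM2l // subr_ge0.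
  by rewrite -mulrDl addrC subrK mul1r.
have [al0 _] := ral.
have [H1 alH1] : exists H, al H = 1.
  have [H alH] : exists H, al H != 0.
    apply/not_existsP => h; case/eqP: al0; apply/lfunP => H; rewrite zero_lfunE.
    by apply/eqP; apply: contra_notT (h H).
  by exists ((al H)^-1 *: H); rewrite linearZ /= /GRing.scale /= mulVf.
have [e e0 ballO] : exists2 e : R, 0 < e &
    forall t, `|t| < e -> C (X + t *: H1).
  move: XO; rewrite /OmegaH /vinterior /interior /=.
  move=> /nbhs_ballP[e /= e0 eb].
  pose N1 := `|coordinates H1|.
  have N10 : 0 <= N1 by exact: normr_ge0.
  (* Then t H1 has coordinates of norm below [e]; adding 1 avoids a zero denominator. *)
  exists (e / (N1 + 1)); first by rewrite divr_gt0 // ltr_wpDl.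
  move=> t te; apply: hullC.
  have coordE : coordinates (X + t *: H1) = coordinates X + t *: coordinates H1.
    by apply/rowP => i; rewrite !mxE linearD linearZ.
  have : ball (coordinates X) e (coordinates (X + t *: H1)).
    rewrite -ball_normE /= coordE opprD addrA subrr add0r normrN normrZ.
    have : `|t| * (N1 + 1) < e by rewrite -ltr_pdivlMr // ltr_wpDl.
    by apply: le_lt_trans; rewrite ler_wpM2l // lerDl.
  move=> /eb[Y YS YE].
  suff <- : Y = X + t *: H1 by [].
  rewrite (coord_vbasis (memvf Y)) [RHS](coord_vbasis (memvf (X + t *: H1))).
  by apply: eq_bigr => i _; move/rowP/(_ i): YE; rewrite !mxE => ->.
have h1 := ballO (e / 2); have h2 := ballO (- (e / 2)).
have e2 : `|e / 2| < e by rewrite ger0_norm ?divr_ge0 // ?ltW // ltr_pdivrMr //; lra.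
rewrite normrN in h2; move: (h1 e2) (h2 e2).
rewrite /C /= !linearD !linearZ /= alH1 /GRing.scale /= !mulr1.
rewrite !ler_norml ltr_norml => /andP[C1 C2] /andP[C3 C4].
by apply/andP; split; lra.
Qed.

End RootValues.

(** * Reflections in restricted roots *)

Section Embedding.
Context {R : realType} {g : lieAlgebra R} {N : nat}.
Variable iota : g -> 'M[Cx R]_N.
Hypothesis hiota : matrix_embedding iota.

Lemma realC1 : realC 1 = 1 :> Cx R. Proof. by []. Qed.

Lemma iotaD X Y : iota (X + Y) = iota X + iota Y.
Proof. by case: hiota => lin _ _; have := lin 1 X Y; rewrite realC1 !scale1r. Qed.

Lemma iota0 : iota 0 = 0.
Proof. by apply: (addrI (iota 0)); rewrite -iotaD !addr0. Qed.

Lemma iotaZ c X : iota (c *: X) = realC c *: iota X.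
Proof. by case: hiota => lin _ _; rewrite -[c *: X]addr0 lin iota0 addr0. Qed.

Lemma iotaN X : iota (- X) = - iota X.
Proof. by apply: (addIr (iota X)); rewrite -iotaD !addNr iota0. Qed.

Lemma iotaB X Y : iota (X - Y) = iota X - iota Y.
Proof. by rewrite iotaD iotaN. Qed.

Lemma iota_sum (I : Type) (r : seq I) (F : I -> g) :
  iota (\sum_(i <- r) F i) = \sum_(i <- r) iota (F i).
Proof. exact: (big_morph iota iotaD iota0). Qed.

Lemma iota_lie X Y : iota (lie X Y) = iota X *m iota Y - iota Y *m iota X.
Proof. by case: hiota. Qed.

Lemma cplx_eq0 X Y : cplx iota X Y = 0 -> X = 0 /\ Y = 0.
Proof. by case: hiota => _ _; apply. Qed.

Lemma iota_eq0 X : iota X = 0 -> X = 0.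
Proof.
move=> X0; have [] // := @cplx_eq0 X 0.
by rewrite /cplx X0 iota0 scaler0 addr0.
Qed.

Lemma iota_inj : injective iota.
Proof.
move=> X Y XY; apply/eqP; rewrite -subr_eq0; apply/eqP/iota_eq0.
by rewrite iotaB XY subrr.
Qed.

Lemma cplxD X Y X' Y' : cplx iota (X + X') (Y + Y') = cplx iota X Y + cplx iota X' Y'.
Proof. by rewrite /cplx !iotaD scalerDr addrACA. Qed.

Lemma lie_of_expm (G : set 'M[Cx R]_N) W : lie_of G W -> G (expm W).
Proof. by move=> /(_ 1); rewrite realC1 scale1r. Qed.

Variable G : set 'M[Cx R]_N.
Hypothesis hG : connected_group_of iota G.

Lemma group_G : matrix_group G. Proof. by case: hG => -[]. Qed.

Lemma G_unit x : G x -> x \in unitmx.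
Proof. by case: group_G => Gu _ _ _; exact: Gu. Qed.

Lemma G_expm X : G (expm (iota X)).
Proof. by case: hG => _ _ Glie; apply: lie_of_expm; rewrite Glie; exists X. Qed.

(** The conjugate of exp(tX) by [h] is a one-parameter group in [G], so its generator lies in the
    image of [iota]. *)
Lemma group_adjoint h X : G h -> exists X', h *m iota X = iota X' *m h.
Proof.
move=> Gh; have hu := G_unit Gh; case: (group_G) => _ _ GM GV.
have [_ _ Glie] := hG.
have : lie_of G (h *m iota X *m invmx h).
  move=> t.
  have conj : h *m (realC t *: iota X) = (realC t *: (h *m iota X *m invmx h)) *m h.
    by rewrite -scalemxAl -!mulmxA mulVmx // mulmx1 scalemxAr.
  have -> : expm (realC t *: (h *m iota X *m invmx h)) =
      h *m expm (realC t *: iota X) *m invmx h.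
    by rewrite (expm_conj conj) mulmxK.
  by apply: (GM); [apply: (GM) => //; rewrite -iotaZ; exact: G_expm | exact: GV].
by rewrite Glie => -[X' _ X'E]; exists X'; rewrite X'E mulmxKV.
Qed.

Variables (theta : 'End(g)) (a : {vspace g}).
Hypothesis htheta : cartan_involution theta.
Hypothesis ha : maximal_abelian_in (pspace theta) a.

(* With [[theta E, E] = c T], the element [U = pi / (2 sqrt c) (E + theta E)]
   rotates the plane of [T] and [V = (E - theta E) / sqrt c] by the angle
   [pi], hence induces the reflection on [a]. *)
Lemma reflection_lift (ga : dual_space a) T : restricted_root ga -> coroot ga T ->
  exists2 h, G h & forall H : subvs_of a,
    h *m iota (vsval H) = iota (vsval (H - (ga H : R) *: T)) *m h.
Proof.
move=> [ga0 [E rE E0]] cT; have [gaT _] := cT.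
have [c c0 EE] := root_bracket htheta ha ga0 E0 rE cT.
have rtE := root_space_theta htheta ha rE.
pose q := (Num.sqrt c)^-1; pose r := pi / 2 * q.
have sc0 : 0 < Num.sqrt c by rewrite sqrtr_gt0.
have q0 : q != 0 by rewrite invr_eq0 gt_eqF.
have qqc : q * q * c = 1.
  rewrite -[c in LHS]sqr_sqrtr ?ltW // /q; field.
  by rewrite gt_eqF.
pose U := r *: (E + theta E); pose V := q *: (E - theta E).
have lieUH (H : subvs_of a) : lie U (vsval H) = - (r * ga H) *: (E - theta E).
  rewrite /U lieZl lieC lieDr rE rtE opp_lfunE scaleNr -scalerBr scalerN.
  by rewrite scalerA scaleNr.
have lieUT : lie U (vsval T) = - pi *: V.
  rewrite lieUH gaT /V scalerA; congr (_ *: _); rewrite /r.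
  by field.
have lieUV : lie U V = pi *: vsval T.
  rewrite /U /V lieZl lieZr scalerA lieDl.
  rewrite !lieDr !lieNr !lie_alt (lieC E) EE opprK oppr0 add0r addr0.
  rewrite -scalerDl scalerA; congr (_ *: _).
  by rewrite /r -[pi in RHS]mulr1 -[in RHS]qqc; field.
exists (expm (iota U)); first exact: G_expm.
set h := expm (iota U); have Gh : G h by exact: G_expm.
have hu := G_unit Gh.
have cisP : cis (pi : R) = -1.
  by rewrite /cis cospi sinpi; congr Complex; rewrite /= ?oppr0.
(* T + iV is an eigenvector of ad U with eigenvalue i pi, and e^(i pi) = -1. *)
have rot : h *m cplx iota (vsval T) V = - (cplx iota (vsval T) V *m h).
  rewrite -scaleN1r -cisP; apply: expm_eigen_conj.
  rewrite /cplx mulmxDr mulmxDl -!scalemxAr -!scalemxAl opprD addrACA -scalerBr.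
  rewrite -!iota_lie lieUT lieUV (iotaZ (- pi)) (iotaZ pi) scalerDr !scalerA addrC.
  congr (_ + _ *: _); rewrite mulrAC -expr2 /imC /realC.
  by apply/eqP; rewrite eq_complex /=; apply/andP; split; apply/eqP; ring.
(* Conjugation by [h] preserves the real form, so the real part of the relation for T + iV can be
   read off. *)
have hT : h *m iota (vsval T) = - (iota (vsval T) *m h).
  have [T' TE] := group_adjoint (vsval T) Gh.
  have [V' VE] := group_adjoint V Gh.
  have : cplx iota (T' + vsval T) (V' + V) = 0.
    apply: (can_inj (mulmxK hu)); rewrite mul0mx cplxD mulmxDl.
    have -> : cplx iota T' V' *m h = h *m cplx iota (vsval T) V.
      by rewrite [LHS]mulmxDl [RHS]mulmxDr -[in LHS]scalemxAl -[in RHS]scalemxAr TE VE.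
    by rewrite rot addNr.
  move=> /cplx_eq0[/eqP]; rewrite addr_eq0 => /eqP T'E _.
  by rewrite TE T'E iotaN mulNmx.
have hker (H : subvs_of a) : ga H = 0 -> h *m iota (vsval H) = iota (vsval H) *m h.
  move=> gH; rewrite /h; apply/esym/expm_conj/esym/eqP.
  by rewrite -subr_eq0 -iota_lie lieUH gH mulr0 oppr0 scale0r iota0.
move=> H; pose H' := H - ((ga H : R) / 2) *: T.
have gaH' : ga H' = 0.
  by rewrite /H' linearB linearZ /= gaT /GRing.scale /= divfK ?subrr // pnatr_eq0.
have HE : H = H' + ((ga H : R) / 2) *: T by rewrite subrK.
have HE' : H - (ga H : R) *: T = H' - ((ga H : R) / 2) *: T.
  rewrite /H' -addrA -opprD -scalerDl; congr (_ - _ *: _).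
  by field.
have v1 : vsval H = vsval H' + ((ga H : R) / 2) *: vsval T.
  by rewrite {1}HE linearD linearZ.
have v2 : vsval (H - (ga H : R) *: T) = vsval H' - ((ga H : R) / 2) *: vsval T.
  by rewrite HE' linearB linearZ.
rewrite v1 v2; move: (vsval H') (hker _ gaH') => u hu'.
rewrite iotaD iotaB !iotaZ mulmxDr mulmxBl hu'.
by rewrite -scalemxAr hT -scalemxAl scalerN.
Qed.

(** Conjugation by the lift of the reflection carries a root vector of [al] to one whose root is
    [al] composed with the reflection. *)
Lemma reflection_root (al ga : dual_space a) T :
  restricted_root al -> restricted_root ga -> coroot ga T ->
  restricted_root (al - (al T : R) *: ga : dual_space a).
Proof.
move=> [al0 [X rX X0]] rga cT; have [gaT _] := cT.
split.
  (* If [al] were al(T) times [ga], evaluation at [T] would give al(T) = 2 al(T). *)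
  apply: contra al0 => /eqP h.
  have alT : al T = 0.
    have /lfunP /(_ T) := h; rewrite add_lfunE opp_lfunE scale_lfunE gaT zero_lfunE.
    by rewrite /GRing.scale /= => e; lra.
  by rewrite -h alT scale0r subr0.
have [h Gh hH] := reflection_lift rga cT.
have hu := G_unit Gh.
have [X' XE] := group_adjoint X Gh.
exists X'; last first.
  apply: contra X0 => /eqP X'0; apply/eqP/iota_eq0.
  by apply: (can_inj (mulKmx hu)); rewrite XE X'0 iota0 mul0mx mulmx0.
move=> H; apply: iota_inj; apply: (can_inj (mulmxK hu)).
(* The reflection is an involution, so H' is the preimage of H. *)
pose H' := H - (ga H : R) *: T.
have gaH' : ga H' = - ga H :> R.
  by rewrite /H' linearB linearZ /= gaT /GRing.scale /=; lra.
have hH' : h *m iota (vsval H') = iota (vsval H) *m h.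
  rewrite hH; congr (iota (vsval _) *m _).
  by rewrite gaH' /H' scaleNr opprK subrK.
rewrite iota_lie mulmxBl -!mulmxA -XE -hH' !mulmxA -XE -hH' -!mulmxA.
rewrite -mulmxBr -iota_lie rX iotaZ iotaZ -scalemxAr XE -scalemxAl.
congr (realC _ *: _); rewrite /H' linearB linearZ add_lfunE opp_lfunE scale_lfunE /=.
by rewrite /GRing.scale /= mulrC.
Qed.

End Embedding.

(** * The adjoint action in a basis of weight vectors *)

Section Coordinates.
Context {R : realType} {g : lieAlgebra R} {N : nat}.
Variables (theta : 'End(g)) (a : {vspace g}).
Hypothesis htheta : cartan_involution theta.
Hypothesis ha : maximal_abelian_in (pspace theta) a.
Variable iota : g -> 'M[Cx R]_N.
Hypothesis hiota : matrix_embedding iota.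

Variable G : set 'M[Cx R]_N.

Local Notation b := (cartan_form theta).

Lemma exists_weight_family : exists (d : nat) (e : 'I_d -> g) (al : 'I_d -> dual_space a),
  [/\ forall j, e j != 0, forall j, root_space (al j) (e j),
      forall j k, j != k -> b (e j) (e k) = 0
    & forall x, x = \sum_j (b x (e j) / b (e j) (e j)) *: e j].
Proof.
have [s [sP so sx]] := exists_weight_basis htheta ha.
pose e (j : 'I_(size s)) := s`_j.
have es j : e j \in s by exact: mem_nth.
have weights j : exists al : dual_space a, root_space al (e j).
  by case: (sP _ (es j)).
have [al alP] := choice weights.
exists (size s), e, al; split=> //.
- by move=> j; case: (sP _ (es j)).
- have lt (j k : 'I_(size s)) : (j < k)%N -> b (e j) (e k) = 0.
    move=> jk; apply/eqP.
    by move/(pairwiseP 0): so => /(_ j k); apply => //; exact: ltn_ord.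
  move=> j k; rewrite neq_ltn => /orP[/lt //|/lt kj].
  by rewrite (cartan_formC htheta).
- by move=> x; rewrite {1}(sx x) (big_nth 0) big_mkord.
Qed.

Variables (d : nat) (e : 'I_d -> g) (al : 'I_d -> dual_space a).
Hypothesis e0 : forall j, e j != 0.
Hypothesis eroot : forall j, root_space (al j) (e j).
Hypothesis eorth : forall j k, j != k -> b (e j) (e k) = 0.
Hypothesis eE : forall x, x = \sum_j (b x (e j) / b (e j) (e j)) *: e j.

Let blin := @cartan_form_linear R g theta.

Definition wcoord (x : g) (j : 'I_d) : R := b x (e j) / b (e j) (e j).

Lemma norm_e j : 0 < b (e j) (e j).
Proof. exact: (cartan_form_pos htheta (e0 j)). Qed.

Lemma norm_e0 j : b (e j) (e j) != 0.
Proof. by rewrite gt_eqF // norm_e. Qed.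

Lemma wcoordE x : x = \sum_j wcoord x j *: e j.
Proof. exact: eE. Qed.

Lemma wcoord0 j : wcoord 0 j = 0.
Proof. by rewrite /wcoord (form0l blin) mul0r. Qed.

Lemma wcoordD x y j : wcoord (x + y) j = wcoord x j + wcoord y j.
Proof. by rewrite /wcoord (formDl blin) mulrDl. Qed.

Lemma wcoordZ c x j : wcoord (c *: x) j = c * wcoord x j.
Proof. by rewrite /wcoord (formZl blin) mulrA. Qed.

Lemma wcoord_sum (I : Type) (r : seq I) (F : I -> g) j :
  wcoord (\sum_(i <- r) F i) j = \sum_(i <- r) wcoord (F i) j.
Proof. exact: (big_morph (wcoord^~ j) (fun x y => wcoordD x y j) (wcoord0 j)). Qed.

Lemma wcoord_e k j : wcoord (e k) j = (j == k)%:R.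
Proof.
rewrite /wcoord; have [->|jk] := eqVneq j k; first by rewrite divff // norm_e0.
by rewrite eorth ?mul0r // eq_sym.
Qed.

Lemma wcoord_comb (c : 'I_d -> R) j : wcoord (\sum_k c k *: e k) j = c j.
Proof.
rewrite wcoord_sum (bigD1 j) //= wcoordZ wcoord_e eqxx mulr1 big1 ?addr0 // => k kj.
by rewrite wcoordZ wcoord_e eq_sym (negbTE kj) mulr0.
Qed.

(** Weight vectors of distinct weights are orthogonal, because each ad H is symmetric. *)
Lemma wcoord_root_space (mu : dual_space a) y j :
  root_space mu y -> wcoord y j != 0 -> al j = mu.
Proof.
move=> ry cy; apply/lfunP => H.
have by0 : b y (e j) != 0 by apply: contra cy => /eqP h; rewrite /wcoord h mul0r.
have := cartan_form_adjoint htheta (vsval H) y (e j).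
rewrite ry (theta_a ha (subvsP H)) lieNl eroot (formZl blin).
rewrite (cartan_formC htheta y (- _)) (formNl blin) (formZl blin) opprK.
by rewrite (cartan_formC htheta (e j)) => /(mulIf by0).
Qed.

(** A change of basis for the trace, from [vbasis] to the weight vectors. *)
Lemma trace_wcoord (f : g -> g) : linear f -> trace f = \sum_j wcoord (f (e j)) j.
Proof.
move=> lf; rewrite /trace.
under eq_bigr => i _.
  rewrite {1}(wcoordE (vbasis {:g})`_i) -(linfunE lf) linear_sum linear_sum /=.
  under eq_bigr => j _ do rewrite linearZ /= linearZ /= linfunE //.
  over.
rewrite exchange_big /=; apply: eq_bigr => j _.
rewrite {2}(coord_vbasis (memvf (f (e j)))) wcoord_sum; apply: eq_bigr => i _.
by rewrite wcoordZ /GRing.scale /= mulrC.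
Qed.

Definition wvec (x : g) : 'cV[Cx R]_d := \col_j realC (wcoord x j).

Definition basis_mx (j : 'I_d) : 'M[Cx R]_N := iota (e j).

Lemma lincomb_wvec x : lincomb basis_mx (wvec x) = iota x.
Proof.
rewrite [in RHS](wcoordE x) (iota_sum hiota); apply: eq_bigr => j _.
by rewrite mxE (iotaZ hiota).
Qed.

Lemma wvec_e k : wvec (e k) = delta_mx k 0.
Proof.
by apply/colP => j; rewrite !mxE wcoord_e eqxx andbT /realC rmorph_nat.
Qed.

Lemma col_decomp (v : 'cV[Cx R]_d) : v = \sum_k v k 0 *: wvec (e k).
Proof.
rewrite {1}[v]matrix_sum_delta; apply: eq_bigr => k _.
by rewrite big_ord1 wvec_e.
Qed.

(** Splitting [v] into real and imaginary parts reduces this to injectivity of the complexified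
    [iota]. *)
Lemma injE v : lincomb basis_mx v = 0 -> v = 0.
Proof.
pose x := \sum_k complex.Re (v k 0) *: e k; pose y := \sum_k complex.Im (v k 0) *: e k.
have vE : v = wvec x + imC R *: wvec y.
  apply/colP => j; rewrite !mxE /x /y !wcoord_comb mulrC [LHS]complexE.
  by rewrite mulrC.
rewrite vE lincombD lincombZ !lincomb_wvec => /(cplx_eq0 hiota)[-> ->].
by apply/colP => j; rewrite !mxE wcoord0 /realC rmorph0 mulr0 addr0.
Qed.

Lemma lincomb_inj v w : lincomb basis_mx v = lincomb basis_mx w -> v = w.
Proof.
move=> vw; apply/eqP; rewrite -subr_eq0; apply/eqP/injE.
by rewrite lincombB vw subrr.
Qed.

Definition adR (x : g) : 'M[Cx R]_d := \matrix_(i, j) realC (wcoord (lie x (e j)) i).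

Definition adC (v : 'cV[Cx R]_d) : 'M[Cx R]_d := \sum_k v k 0 *: adR (e k).

Lemma adCD v w : adC (v + w) = adC v + adC w.
Proof.
by rewrite /adC -big_split; apply: eq_bigr => k _; rewrite mxE scalerDl.
Qed.

Lemma adCZ c v : adC (c *: v) = c *: adC v.
Proof.
by rewrite /adC scaler_sumr; apply: eq_bigr => k _; rewrite mxE scalerA.
Qed.

Lemma adC_wvec x : adC (wvec x) = adR x.
Proof.
apply/matrixP => i j; rewrite summxE mxE {2}(wcoordE x) lie_suml wcoord_sum.
rewrite /realC rmorph_sum; apply: eq_bigr => k _.
by rewrite !mxE lieZl wcoordZ rmorphM.
Qed.

Lemma adR_wvec x y : adR x *m wvec y = wvec (lie x y).
Proof.
apply/colP => i; rewrite !mxE {2}(wcoordE y) lie_sumr wcoord_sum /realC rmorph_sum.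
by apply: eq_bigr => k _; rewrite !mxE lieZr wcoordZ -rmorphM mulrC.
Qed.

Lemma lincomb_ad v w :
  lincomb basis_mx v *m lincomb basis_mx w =
  lincomb basis_mx (adC v *m w) + lincomb basis_mx w *m lincomb basis_mx v.
Proof.
have step x : iota x *m lincomb basis_mx w =
    lincomb basis_mx (adR x *m w) + lincomb basis_mx w *m iota x.
  have -> : lincomb basis_mx (adR x *m w) = \sum_k w k 0 *: iota (lie x (e k)).
    rewrite {1}(col_decomp w) mulmx_sumr lincomb_sum; apply: eq_bigr => k _.
    by rewrite -scalemxAr lincombZ adR_wvec lincomb_wvec.
  have -> : lincomb basis_mx w = \sum_k w k 0 *: iota (e k) by [].
  rewrite mulmx_sumr mulmx_suml -big_split /=; apply: eq_bigr => k _.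
  by rewrite -scalemxAr -scalemxAl -scalerDr (iota_lie hiota) subrK.
have -> : lincomb basis_mx (adC v *m w) = \sum_k v k 0 *: lincomb basis_mx (adR (e k) *m w).
  rewrite /adC mulmx_suml lincomb_sum; apply: eq_bigr => k _.
  by rewrite -scalemxAl lincombZ.
have -> : lincomb basis_mx v = \sum_k v k 0 *: iota (e k) by [].
rewrite mulmx_suml mulmx_sumr -big_split /=; apply: eq_bigr => k _.
by rewrite -scalemxAl -scalemxAr -scalerDr step.
Qed.

(** Conjugation preserves matrix commutators, so Ad y is an automorphism of the complexified Lie
    algebra. *)
Lemma adrel_adC y A v : adrel basis_mx y A -> A *m adC v = adC (A *m v) *m A.
Proof.
move=> yA; have [yu yAE] := yA.
apply/matrixP => i j; set w : 'cV[Cx R]_d := delta_mx j 0.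
suff : A *m adC v *m w = adC (A *m v) *m A *m w.
  by rewrite -!colE => /colP /(_ i); rewrite !mxE.
apply: lincomb_inj; apply: (can_inj (mulmxK yu)).
rewrite -!mulmxA -yAE.
have -> : lincomb basis_mx (adC v *m w) =
    lincomb basis_mx v *m lincomb basis_mx w -
    lincomb basis_mx w *m lincomb basis_mx v.
  by rewrite lincomb_ad addrK.
have -> : lincomb basis_mx (adC (A *m v) *m (A *m w)) =
    lincomb basis_mx (A *m v) *m lincomb basis_mx (A *m w) -
    lincomb basis_mx (A *m w) *m lincomb basis_mx (A *m v).
  by rewrite lincomb_ad addrK.
by rewrite mulmxBr mulmxBl !mulmxA !yAE -!mulmxA !yAE.
Qed.

Definition Theta : 'M[Cx R]_d := \matrix_(i, j) realC (wcoord (theta (e j)) i).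

Lemma Theta_wvec x : Theta *m wvec x = wvec (theta x).
Proof.
apply/colP => i; rewrite !mxE {2}(wcoordE x) linear_sum wcoord_sum /realC rmorph_sum.
by apply: eq_bigr => k _; rewrite !mxE linearZ wcoordZ -rmorphM mulrC.
Qed.

Definition gram : 'rV[Cx R]_d := \row_j realC (b (e j) (e j)).

(** The complex bilinear, not Hermitian, extension of [cartan_form] is rewritten as a trace, from
    which invariance under automorphisms commuting with [Theta] is visible. *)
Lemma gramE v w :
  (v^T *m diag_mx gram *m w) 0 0 = - \tr (adC v *m adC (Theta *m w)).
Proof.
have basis j k : \tr (adR (e j) *m adR (theta (e k))) = - realC (b (e j) (e k)).
  rewrite /cartan_form /killing trace_wcoord; last first.
    exact: linear_comp (lie_linear _) (lie_linear _).
  rewrite /realC rmorphN opprK /mxtrace rmorph_sum; apply: eq_bigr => i _.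
  rewrite mxE (wcoordE (lie (theta (e k)) (e i))) lie_sumr wcoord_sum rmorph_sum.
  by apply: eq_bigr => l _; rewrite !mxE lieZr wcoordZ -rmorphM mulrC.
have adTw : adC (Theta *m w) = \sum_k w k 0 *: adR (theta (e k)).
  rewrite {1}(col_decomp w) mulmx_sumr.
  rewrite (big_morph adC adCD (_ : adC 0 = 0)); last first.
    by rewrite /adC big1 // => k _; rewrite mxE scale0r.
  by apply: eq_bigr => k _; rewrite -scalemxAr adCZ Theta_wvec adC_wvec.
rewrite adTw {1}/adC mulmx_suml. rewrite [X in - X]linear_sum /= -sumrN.
rewrite mxE; apply: eq_bigr => k _.
rewrite mul_mx_diag !mxE -scalemxAl mxtraceZ mulmx_sumr.
rewrite [X in - (_ * X)]linear_sum /= mulr_sumr -sumrN.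
rewrite (bigD1 k) //= big1 => [|l lk].
  by rewrite -scalemxAr mxtraceZ basis !mulrN opprK addr0 mulrA mulrAC.
rewrite -scalemxAr mxtraceZ basis eorth; last by rewrite eq_sym.
by rewrite /realC rmorph0 oppr0 !mulr0 oppr0.
Qed.

Lemma gram_invariant y A : adrel basis_mx y A -> A *m Theta = Theta *m A ->
  A^T *m diag_mx gram *m A = diag_mx gram.
Proof.
move=> yA AT; have Au := adrel_unit injE yA.
have key (v w : 'cV[Cx R]_d) : (v^T *m (A^T *m diag_mx gram *m A) *m w) 0 0 =
    (v^T *m diag_mx gram *m w) 0 0.
  have -> : v^T *m (A^T *m diag_mx gram *m A) *m w =
      (A *m v)^T *m diag_mx gram *m (A *m w) by rewrite trmx_mul !mulmxA.
  rewrite !gramE mulmxA -AT -mulmxA; congr (- _).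
  have cA u : adC (A *m u) = A *m adC u *m invmx A.
    by rewrite (adrel_adC _ yA) mulmxK.
  by rewrite !cA -!mulmxA mulKmx // mxtrace_mulC !mulmxA mulmxKV.
apply/matrixP => i j; have := key (delta_mx i 0) (delta_mx j 0).
by rewrite !trmx_delta -!rowE -!colE !mxE.
Qed.

(** Obtained by inverting A^T G A = G. With the dual form the rightmost factor of a product cancels
    first, as the comparison of the two sides requires. *)
Lemma gram_dual_invariant y A : adrel basis_mx y A -> A *m Theta = Theta *m A ->
  A *m diag_mx (\row_j (gram 0 j)^-1) *m A^T = diag_mx (\row_j (gram 0 j)^-1).
Proof.
move=> yA AT; set gi := diag_mx _; have Au := adrel_unit injE yA.
have gg : gi *m diag_mx gram = 1%:M.
  rewrite /gi mulmx_diag -[RHS]diag_const_mx; congr diag_mx.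
  apply/rowP => j; rewrite !mxE mulVf //.
  by rewrite /realC fmorph_eq0 norm_e0.
have gg' : diag_mx gram *m gi = 1%:M by rewrite -diag_mxC.
have inv := gram_invariant yA AT.
have h : gi *m A^T *m diag_mx gram *m A = 1%:M.
  by rewrite -!mulmxA [A^T *m _]mulmxA inv.
have h2 : A *m (gi *m A^T *m diag_mx gram) = 1%:M by exact: mulmx1C.
have -> : A *m gi *m A^T = A *m (gi *m A^T *m diag_mx gram) *m gi.
  by rewrite -!mulmxA gg' mulmx1.
by rewrite h2 mul1mx.
Qed.

Lemma wvecZ c x : wvec (c *: x) = realC c *: wvec x.
Proof. by apply/colP => j; rewrite !mxE wcoordZ /realC rmorphM. Qed.

Lemma wvec0 : wvec 0 = 0.
Proof. by apply/colP => j; rewrite !mxE wcoord0 /realC rmorph0. Qed.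

Lemma cplx_lincomb X Y : cplx iota X Y = lincomb basis_mx (wvec X + imC R *: wvec Y).
Proof. by rewrite lincombD lincombZ !lincomb_wvec. Qed.

Lemma adrel_cplx X Y : expm (cplx iota X Y) \in unitmx ->
  adrel basis_mx (expm (cplx iota X Y)) (expm (adR X + imC R *: adR Y)).
Proof.
move=> Wu; apply: adrel_expm => // v.
by rewrite cplx_lincomb lincomb_ad adCD adCZ !adC_wvec.
Qed.

Lemma adrel_wvec y A X X' : adrel basis_mx y A -> y *m iota X = iota X' *m y ->
  A *m wvec X = wvec X'.
Proof.
move=> [yu yA] XX'; apply: lincomb_inj; apply: (can_inj (mulmxK yu)).
by rewrite -yA !lincomb_wvec.
Qed.

(** Each weight vector is an eigenvector; the zero term [adR 0] matches the shape in
    [adrel_cplx]. *)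
Lemma expm_torus (H : subvs_of a) :
  expm (adR 0 + imC R *: adR (vsval H)) = diag_mx (\row_j cis (al j H)).
Proof.
apply/matrixP => i j.
have eig : (adR 0 + imC R *: adR (vsval H)) *m wvec (e j) =
    (imC R * realC (al j H)) *: wvec (e j).
  by rewrite mulmxDl -scalemxAl !adR_wvec lie0l wvec0 add0r eroot wvecZ scalerA.
have /colP /(_ i) := expm_eigen eig.
rewrite wvec_e -colE !mxE eqxx andbT mulr_natr => ->.
by have [->|] := eqVneq i j; rewrite ?mulr0n.
Qed.

Lemma adR_torus (H : subvs_of a) :
  adR (vsval H) = diag_mx (\row_j realC (al j H)).
Proof.
apply/matrixP => i j.
rewrite !mxE eroot wcoordZ wcoord_e /realC rmorphM rmorph_nat mulr_natr.
by have [->|] := eqVneq i j; rewrite ?mulr0n.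
Qed.

Lemma adrel_real h : h \in unitmx ->
  (forall X, exists X', h *m iota X = iota X' *m h) ->
  exists A, adrel basis_mx h A /\ forall i j, A i j \is Num.real.
Proof.
move=> hu hX.
have [f fE] := choice (fun k => hX (e k)).
exists (\matrix_(i, j) realC (wcoord (f j) i)); split; last first.
  by move=> i j; rewrite mxE; exact: realC_real.
split=> // v.
have -> : (\matrix_(i, j) realC (wcoord (f j) i)) *m v = \sum_k v k 0 *: wvec (f k).
  apply/colP => i; rewrite mxE summxE; apply: eq_bigr => k _.
  by rewrite !mxE mulrC.
rewrite lincomb_sum mulmx_sumr mulmx_suml; apply: eq_bigr => k _.
by rewrite lincombZ lincomb_wvec -scalemxAr fE scalemxAl.
Qed.

(** The property is stable under products and inverses, so generators suffice: [K] by hypothesis,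
    and exp(X + iY) since ad X and ad Y commute with [Theta] when [theta] fixes X and Y. *)
Lemma complexified_subgroup_adrel (GC K : set 'M[Cx R]_N) :
  connected_complexification_of iota G GC ->
  (forall k, K k -> k \in unitmx /\ forall X, exists2 X',
     k *m iota X = iota X' *m k & k *m iota (theta X) = iota (theta X') *m k) ->
  forall y, complexified_subgroup iota (kspace theta) K y ->
  exists2 A, adrel basis_mx y A & A *m Theta = Theta *m A.
Proof.
move=> hGC hK.
apply: smallest_sub.
  split.
  - by move=> x [A []].
  - by exists 1%:M; [exact: adrel1|rewrite mul1mx mulmx1].
  - move=> x y [A xA AT] [B yB BT]; exists (A *m B); first exact: adrelM.
    by rewrite -mulmxA BT !mulmxA AT.
  - move=> x [A xA AT]; have Au := adrel_unit injE xA.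
    exists (invmx A); first exact: (adrelV injE).
    by apply: (can_inj (mulKmx Au)); rewrite mulKVmx // mulmxA AT mulmxK.
move=> y [Ky|].
  have [yu yX] := hK _ Ky.
  have [|A [yA _]] := adrel_real yu.
    by move=> X; have [X' ? _] := yX X; exists X'.
  exists A => //; apply/matrixP => i j.
  suff : A *m Theta *m wvec (e j) = Theta *m A *m wvec (e j).
    by rewrite wvec_e -!colE => /colP /(_ i); rewrite !mxE.
  have [X' X1 X2] := yX (e j).
  by rewrite -!mulmxA Theta_wvec (adrel_wvec yA X1) (adrel_wvec yA X2) Theta_wvec.
move=> [X Xk [Y Yk <-]].
have [[[GCu _ _ _] _] _ _ GClie] := hGC.
have Wu : expm (cplx iota X Y) \in unitmx.
  have : lie_of GC (cplx iota X Y) by rewrite GClie; exists X => //; exists Y.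
  by move=> /lie_of_expm/GCu.
exists (expm (adR X + imC R *: adR Y)); first exact: adrel_cplx.
have comm V : theta V = V -> adR V *m Theta = Theta *m adR V.
  move=> tV; apply/matrixP => i j.
  suff : adR V *m Theta *m wvec (e j) = Theta *m adR V *m wvec (e j).
    by rewrite wvec_e -!colE => /colP /(_ i); rewrite !mxE.
  by rewrite -!mulmxA Theta_wvec !adR_wvec Theta_wvec (theta_lie htheta) tV.
have tX : theta X = X by apply/fixedSpaceP; exact: Xk.
have tY : theta Y = Y by apply/fixedSpaceP; exact: Yk.
apply: expm_intertwine.
by rewrite mulmxDl mulmxDr -scalemxAl -scalemxAr !comm.
Qed.

(** Commuting with all exp(tH) means that Ad m fixes H, and an automorphism fixing H commutes with
    ad H. *)
Lemma adrel_centralizer m A : adrel basis_mx m A ->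
  (forall x, torusA iota a x -> m *m x = x *m m) ->
  forall H : subvs_of a, A *m adR (vsval H) = adR (vsval H) *m A.
Proof.
move=> mA comm H; have [mu _] := mA.
have mH : m *m iota (vsval H) = iota (vsval H) *m m.
  apply: (expm_conj_ray mu) => t; apply: comm; exists (t *: H); first by [].
  by congr expm; rewrite linearZ (iotaZ hiota).
have := adrel_adC (wvec (vsval H)) mA.
by rewrite (adrel_wvec mA mH) !adC_wvec.
Qed.

Variables (n : nat) (Pi : n.-tuple (dual_space a)).
Hypothesis hPi : root_basis Pi.

Definition height (mu : dual_space a) : R := \sum_i coord Pi i mu.

Definition ht (j : 'I_d) : R := height (al j).

Lemma heightD mu nu : height (mu + nu) = height mu + height nu.
Proof. by rewrite /height -big_split; apply: eq_bigr => i _; rewrite raddfD. Qed.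

Lemma height_positive_root mu : positive_root Pi mu -> 0 < height mu.
Proof.
move=> [[mu0 _] [c muE]]; case: (hPi) => /basis_free Pfree _ _.
have cE i : coord Pi i mu = (c i)%:R.
  have -> : mu = \sum_(i < n) (c i)%:R *: Pi`_i.
    by rewrite muE; apply: eq_bigr => k _; rewrite (tnth_nth 0).
  by rewrite coord_sum_free.
have h0 i : 0 <= coord Pi i mu :> R by rewrite cE ler0n.
rewrite lt0r sumr_ge0 // andbT; apply: contra mu0 => h.
rewrite muE big1 // => i _; move: h; rewrite psumr_eq0 // => /allP /(_ i).
by rewrite mem_index_enum cE => /(_ isT) /implyP /(_ isT) /eqP ->; rewrite scale0r.
Qed.

(** A root vector for a positive root mu shifts weights by mu, whose height is positive. *)
Lemma nilpotent_part_strict X : nilpotent_part Pi X -> strict_tri ht (adR X).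
Proof.
move=> [m [mu [F [muF ->]]]] j k jk; rewrite mxE lie_suml wcoord_sum big1 ?rmorph0 //.
move=> i _; apply/eqP; apply: contraNT jk => cn.
have [pos rF] := muF i.
have := wcoord_root_space (root_space_lie rF (eroot k)) cn.
by rewrite /ht => ->; rewrite heightD ltrDr height_positive_root.
Qed.

Lemma unipotent_unitri y : unipotentNC iota Pi y -> y \in unitmx ->
  exists2 U, adrel basis_mx y U & unitri ht U.
Proof.
move=> [X Xn [Y Yn <-]] yu; exists (expm (adR X + imC R *: adR Y)).
  exact: adrel_cplx.
apply: expm_unitri => j k jk.
by rewrite mxE [X in _ + X]mxE !nilpotent_part_strict // mulr0 addr0.
Qed.

End Coordinates.

(** * The contradiction *)

Section Cis.
Context {R : realType}.

Lemma cis_sqr (t : R) :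
  cis t ^+ 2 = Complex (cos t ^+ 2 - sin t ^+ 2) (2 * (sin t * cos t)) :> Cx R.
Proof.
rewrite expr2; apply/eqP; rewrite eq_complex /=.
by apply/andP; split; apply/eqP; ring.
Qed.

Lemma Im_real (x : Cx R) : x \is Num.real -> complex.Im x = 0.
Proof.
case: x => u v; rewrite realE !lecE /= => /orP[] /andP[/eqP h _].
  exact: h.
exact: esym h.
Qed.

(** The imaginary part of e^(2it) is 2 sin t cos t with cos t > 0, so reality forces sin t = 0. *)
Lemma cis_sqr_real_gt0 (t r : R) : 0 < r -> `|t| < pi / 2 ->
  cis t ^+ 2 * realC r \is Num.real -> 0 < cis t ^+ 2 * realC r.
Proof.
move=> r0 tpi /Im_real.
have ct : 0 < cos t by apply: cos_gt0_pihalf; move: tpi; rewrite ltr_norml.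
have -> : cis t ^+ 2 * realC r =
    Complex ((cos t ^+ 2 - sin t ^+ 2) * r) (2 * (sin t * cos t) * r) :> Cx R.
  rewrite cis_sqr /realC; apply/eqP; rewrite eq_complex /=.
  by apply/andP; split; apply/eqP; ring.
move=> /= /eqP; rewrite !mulf_eq0 pnatr_eq0 (gt_eqF ct) (gt_eqF r0) !orbF /=.
move=> /eqP ->; rewrite ltcE /= mul0r mulr0 mul0r eqxx /=.
by rewrite expr0n subr0 mulr_gt0 // exprn_gt0.
Qed.

(** 1 - 2 z^2 interpolates e^(i pi z) at the three values that roots take on Z. *)
Lemma cis_pihalf_sqr (z : R) : [\/ z = -1, z = 0 | z = 1] ->
  cis (pi / 2 * z) ^+ 2 = realC (1 - 2 * z ^+ 2).
Proof.
rewrite cis_sqr /realC => -[] ->; rewrite ?mulrN ?mulr1 ?mulr0 ?cosN ?sinN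
  ?cos_pihalf ?sin_pihalf ?cos0 ?sin0; congr Complex; by ring.
Qed.

End Cis.

Section Final.
Context {R : realType} {g : lieAlgebra R} {N : nat}.
Variable iota : g -> 'M[Cx R]_N.
Hypothesis hiota : matrix_embedding iota.
Variable G : set 'M[Cx R]_N.
Hypothesis hG : connected_group_of iota G.

(** The group involution fixes [k]; applied to k exp(tX) = exp(tX') k it gives the relation for the
    images under [theta], which is then differentiated. *)
Lemma fixed_points_adjoint (theta : 'End(g)) (thetaG : 'M[Cx R]_N -> 'M[Cx R]_N) k :
  exponentiates iota theta G thetaG -> fixed_points G thetaG k ->
  k \in unitmx /\ forall X, exists2 X',
    k *m iota X = iota X' *m k & k *m iota (theta X) = iota (theta X') *m k.
Proof.
move=> [[_ thM] thE] [Gk thk]; have ku := G_unit hG Gk; split=> // X.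
have [X' XE] := group_adjoint hiota hG X Gk; exists X' => //.
have expE u u' U U' : k *m iota u = iota u' *m k ->
    iota (theta u) = U -> iota (theta u') = U' -> k *m expm U = expm U' *m k.
  move=> uu' <- <-; have c1 := congr1 thetaG (expm_conj uu').
  have l1 := thM _ _ Gk (G_expm hG u); have l2 := thM _ _ (G_expm hG u') Gk.
  have f1 := congr2 mulmx thk (thE u); have f2 := congr2 mulmx (thE u') thk.
  exact: etrans (esym f1) (etrans (esym l1) (etrans c1 (etrans l2 f2))).
apply: (expm_conj_ray ku) => t; apply: (expE (t *: X) (t *: X')).
- by rewrite !(iotaZ hiota) -scalemxAr XE scalemxAl.
- by rewrite linearZ (iotaZ hiota).
- by rewrite linearZ (iotaZ hiota).
Qed.

(** A matrix group containing [S] is required: an intersection over an empty family would contain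
    singular matrices. *)
Lemma generated_group (S : set 'M[Cx R]_N) : (exists2 T, matrix_group T & S `<=` T) ->
  matrix_group (generated S).
Proof.
move=> [T Tg ST]; have [Tu _ _ _] := Tg; split.
- by move=> x xS; apply: Tu; apply: (xS T); split.
- by move=> A [[_ A1 _ _] _].
- by move=> x y xS yS A [gA SA]; have [_ _ AM _] := gA; apply: AM; [exact: xS|exact: yS].
- by move=> x xS A [gA SA]; have [_ _ _ AV] := gA; apply: AV; exact: xS.
Qed.

End Final.

Lemma mulmx_congruence (K : comPzRingType) (d : nat) (X Y Z G : 'M[K]_d) :
  (X *m Y *m Z) *m G *m (X *m Y *m Z)^T = X *m (Y *m (Z *m G *m Z^T) *m Y^T) *m X^T.
Proof. by rewrite !trmx_mul !mulmxA. Qed.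

Lemma mulmx_quadratic (K : comPzRingType) (d : nat) (A G : 'M[K]_d) (x : 'cV[K]_d) :
  x^T *m (A *m G *m A^T) *m x = (A^T *m x)^T *m G *m (A^T *m x).
Proof. by rewrite trmx_mul trmxK !mulmxA. Qed.

(** The dual form [gi] is transported by both sides of the identity. On the left [Ak] cancels,
    leaving a real form with a negative value; on the right [Am] cancels, and [unitri_psd] makes it
    nonnegative on real vectors. *)
Lemma indefinite_not_psd (R : realType) (d : nat) (ht : 'I_d -> R)
    (A B Ak Am U : 'M[Cx R]_d) (z w gi : 'rV[Cx R]_d) (j1 : 'I_d) :
  (forall i j, A i j \is Num.real) -> (forall i j, B i j \is Num.real) ->
  B *m A = 1%:M ->
  Ak *m diag_mx gi *m Ak^T = diag_mx gi -> Am *m diag_mx gi *m Am^T = diag_mx gi ->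
  diag_mx w *m Am \in unitmx ->
  (forall j k, (diag_mx w *m Am) j k != 0 -> ht j = ht k) ->
  (forall j k, invmx (diag_mx w *m Am) j k != 0 -> ht j = ht k) ->
  unitri ht U ->
  A *m diag_mx z *m Ak = diag_mx w *m Am *m U ->
  (forall j, z 0 j ^+ 2 * gi 0 j \is Num.real) -> z 0 j1 ^+ 2 * gi 0 j1 < 0 ->
  (forall j, w 0 j ^+ 2 * gi 0 j \is Num.real -> 0 < w 0 j ^+ 2 * gi 0 j) ->
  False.
Proof.
move=> Areal Breal BA AkG AmG Pu Ph Pih tU eqn zreal zneg wpos.
set P := diag_mx w *m Am in Pu Ph Pih eqn.
have tU' := unitri_conj Pu Ph Pih tU; set U' := P *m U *m invmx P in tU'.
(* Moving [P] to the right of the unipotent factor puts [Am] next to [gi]. *)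
have PU : P *m U = U' *m P by rewrite mulmxKV.
pose D : 'rV[Cx R]_d := \row_j (w 0 j ^+ 2 * gi 0 j).
pose Dz : 'rV[Cx R]_d := \row_j (z 0 j ^+ 2 * gi 0 j).
have sandwich (v : 'rV[Cx R]_d) : diag_mx v *m diag_mx gi *m diag_mx v =
    diag_mx (\row_j (v 0 j ^+ 2 * gi 0 j)).
  rewrite !mulmx_diag; congr diag_mx; apply/rowP => j.
  by rewrite !mxE mulrAC expr2.
have QE : A *m diag_mx Dz *m A^T = U' *m diag_mx D *m U'^T.
  have lhs : (A *m diag_mx z *m Ak) *m diag_mx gi *m (A *m diag_mx z *m Ak)^T =
      A *m diag_mx Dz *m A^T.
    by rewrite mulmx_congruence AkG tr_diag_mx sandwich.
  have rhs : (U' *m P) *m diag_mx gi *m (U' *m P)^T = U' *m diag_mx D *m U'^T.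
    by rewrite [U' *m P]mulmxA mulmx_congruence AmG tr_diag_mx sandwich.
  by rewrite -lhs -rhs eqn PU.
have Qreal j k : (U' *m diag_mx D *m U'^T) j k \is Num.real.
  rewrite -QE mxE rpred_sum // => l _; rewrite rpredM ?mul_mx_diag ?mxE //.
  by rewrite rpredM // zreal.
have Dpos l : D 0 l \is Num.real -> 0 < D 0 l by rewrite mxE; exact: wpos.
(* Chosen so that A^T x is the basis vector of index [j1]; it is real because [B] is. *)
pose x : 'cV[Cx R]_d := B^T *m delta_mx j1 0.
have xreal j : x j 0 \is Num.real by rewrite /x -colE !mxE.
have := unitri_psd tU' Dpos Qreal xreal; rewrite -QE.
have Ax : A^T *m x = delta_mx j1 0 by rewrite /x mulmxA -trmx_mul BA trmx1 mul1mx.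
rewrite mulmx_quadratic Ax trmx_delta -rowE -colE !mxE eqxx mulr1n.
by move=> /le_lt_trans /(_ zneg); rewrite ltxx.
Qed.

Lemma commute_weights (R : realType) (g : lieAlgebra R) (a : {vspace g}) (d : nat)
    (al : 'I_d -> dual_space a) (A : 'M[Cx R]_d) j k :
  (forall H, A *m diag_mx (\row_j realC (al j H)) =
             diag_mx (\row_j realC (al j H)) *m A) ->
  A j k != 0 -> al j = al k.
Proof.
move=> comm Ajk; apply/lfunP => H; have /matrixP /(_ j k) := comm H.
rewrite mul_mx_diag mul_diag_mx !mxE mulrC => /(mulIf Ajk) /(congr1 (@complex.Re R)).
by move=> /= ->.
Qed.

Lemma commute_invmx (K : comUnitRingType) (d : nat) (P D : 'M[K]_d) :
  P \in unitmx -> P *m D = D *m P -> invmx P *m D = D *m invmx P.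
Proof.
move=> Pu PD; apply: (can_inj (mulKmx Pu)).
by rewrite mulKVmx // mulmxA PD mulmxK.
Qed.

Theorem theorem1p8 (R : realType) (g : lieAlgebra R)
  (hsimple : @simple_lie R g) (hnc : @noncompact_lie R g)
  (theta : 'End(g)) (htheta : cartan_involution theta)
  (a : {vspace g}) (ha : maximal_abelian_in (pspace theta) a)
  (n : nat) (Pi : n.-tuple (dual_space a)) (hPi : root_basis Pi)
  (i0 : 'I_n) (be : dual_space a) (hbe : highest_root Pi be)
  (hi0 : coord Pi i0 be = 1)
  (Z : subvs_of a) (hZ : forall i, tnth Pi i Z = (i == i0)%:R)
  (sigma : 'End(g)) (hsigma : grading_sign (vsval Z) sigma)
  (N : nat) (iota : g -> 'M[Cx R]_N) (hiota : matrix_embedding iota)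
  (G GC : set 'M[Cx R]_N)
  (hG : connected_group_of iota G)
  (hGC : connected_complexification_of iota G GC)
  (thetaG : 'M[Cx R]_N -> 'M[Cx R]_N)
  (hthetaG : exponentiates iota theta G thetaG)
  (tauG : 'M[Cx R]_N -> 'M[Cx R]_N)
  (htauG : exponentiates iota (sigma \o theta) G tauG)
  (tauGC : 'M[Cx R]_N -> 'M[Cx R]_N)
  (htauGC : complex_exponentiates iota (sigma \o theta) GC tauGC) :
  let ZH := (pi / 2) *: Z in
  let zH := expm (cplx iota 0 (vsval ZH)) in
  let K := fixed_points G thetaG in
  let KC := complexified_subgroup iota (kspace theta) K in
  let MC := centralizerM KC (torusA iota a) in
  let NC := unipotentNC iota Pi in
  Xi_plus iota (OmegaH ZH) G MC NC `<=` Xi_nr G GC KC MC NC zH.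
Proof.
move=> ZH zH K KC MC NC xi [x Gx [X XO] <-].
have [[GCgrp _] _ G_GC GClie] := hGC; have [GCu _ GCM GCV] := GCgrp.
have GCexp V W : GC (expm (cplx iota V W)).
  by apply: lie_of_expm; rewrite GClie; exists V => //; exists W.
have KC_GC : matrix_group KC.
  apply: generated_group; exists GC => //.
  by move=> y [[/G_GC //]|[V _ [W _ <-]]]; exact: GCexp.
have [KCu KC1 KCM KCV] := KC_GC.
have MC1 : MC 1%:M by split=> // y _; rewrite mul1mx mulmx1.
have NC1 : NC 1%:M.
  have n0 : nilpotent_part Pi (0 : g).
    by exists 0%N, (fun=> 0), (fun=> 0); split=> [[]//|]; rewrite big_ord0.
  exists 0 => //; exists 0 => //.
  by rewrite /cplx (iota0 hiota) scaler0 addr0 expm0.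
split; first by exists (x *m expm (cplx iota 0 (vsval X))) => //; apply: GCM => //; exact: G_GC.
apply/seteqP; split=> // u [[x' [y [GCx' xiE NCy uE]]] [h Gh hE]].
(* As 1 lies in MC and NC, x' belongs to its own coset, hence to that of x exp(iX). *)
have [m [n1 [MCm NCn1 x'basis_mx]]] : exists m n1, [/\ MC m, NC n1 &
    x' = x *m expm (cplx iota 0 (vsval X)) *m (m *m n1)].
  have : coset x' (set_mulmx MC NC) x'.
    by exists 1%:M; [exists 1%:M => //; exists 1%:M => //; rewrite mulmx1|rewrite mulmx1].
  by rewrite -xiE => -[_ [m MCm [n1 NCn1 <-]] <-]; exists m, n1.
have [k KCk hk] : exists2 k, KC k & h *m zH *m k = x' *m y.
  have : coset (x' *m y) KC (x' *m y) by exists 1%:M => //; rewrite mulmx1.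
  by rewrite -uE -hE => -[k KCk kE]; exists k.
have xu := G_unit hG Gx.
have [_ _ GM GV] := group_G hG.
(* The element x of G is absorbed into h, leaving exp(iX) alone on the other side. *)
pose h0 := invmx x *m h.
have Gh0 : G h0 by apply: GM => //; exact: GV.
have eqn : h0 *m zH *m k = expm (cplx iota 0 (vsval X)) *m m *m (n1 *m y).
  by rewrite /h0 -!mulmxA [h *m _]mulmxA hk x'basis_mx -!mulmxA mulKmx.
have [d [e [al [e0 eroot eorth eE]]]] := exists_weight_family htheta ha.
have inj := injE htheta hiota e0 eorth eE.
have [A [h0A Areal]] := adrel_real hiota eE (G_unit hG Gh0)
  (fun V => group_adjoint hiota hG V Gh0).
have Gh0V : G (invmx h0) by exact: GV.
(* The inverse of Ad h0 must be real too, since the test vector is built from it. *)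
have [B [h0B Breal]] := adrel_real hiota eE (G_unit hG Gh0V)
  (fun V => group_adjoint hiota hG V Gh0V).
have BA : B *m A = 1%:M.
  apply: (adrel_uniq inj (adrelM h0B h0A)); rewrite mulVmx ?(G_unit hG Gh0) //.
  exact: adrel1.
have torus (H : subvs_of a) : adrel (basis_mx iota e) (expm (cplx iota 0 (vsval H)))
    (diag_mx (\row_j cis (al j H))).
  rewrite -(expm_torus htheta e0 eroot eorth eE).
  by apply: adrel_cplx => //; apply: GCu.
have KCadj c (Kc : KC c) := complexified_subgroup_adrel htheta hiota e0 eorth eE hGC
  (fun k Kk => fixed_points_adjoint hiota hG hthetaG Kk) Kc.
have [Ak kA AkT] := KCadj _ KCk.
have [KCm mcomm] := MCm; have [Am mA AmT] := KCadj _ KCm.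
have Amcomm (H : subvs_of a) := adrel_centralizer htheta hiota e0 eorth eE mA mcomm H.
have NCunit c : NC c -> c \in unitmx by move=> [V _ [W _ <-]]; apply: GCu.
have [U1 n1U1 tU1] := unipotent_unitri htheta ha hiota e0 eroot eorth eE hPi NCn1 (NCunit _ NCn1).
have [U2 yU2 tU2] := unipotent_unitri htheta ha hiota e0 eroot eorth eE hPi NCy (NCunit _ NCy).
(* Both sides of [eqn] are the same group element, so their adjoint matrices coincide. *)
have := adrelM (adrelM h0A (torus ZH)) kA; rewrite eqn => lhsA.
have := adrelM (adrelM (torus X) mA) (adrelM n1U1 yU2) => rhsA.
have matE := adrel_uniq inj lhsA rhsA.
set w := \row_j cis (al j X) in rhsA matE.
set z := \row_j cis (al j ZH) in lhsA matE.
have Pu : diag_mx w *m Am \in unitmx := adrel_unit inj (adrelM (torus X) mA).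
(* Commuting with the weights makes this factor preserve heights. *)
have Pcomm (H : subvs_of a) : diag_mx w *m Am *m diag_mx (\row_j realC (al j H)) =
    diag_mx (\row_j realC (al j H)) *m (diag_mx w *m Am).
  rewrite -(adR_torus htheta e0 eroot eorth) -mulmxA Amcomm !mulmxA.
  by rewrite (adR_torus htheta e0 eroot eorth) [_ *m diag_mx w]diag_mxC.
have rootal j : al j = 0 \/ restricted_root (al j).
  by have [->|alj] := eqVneq (al j) 0; [left|right; split=> //; exists (e j)].
have alZ j : [\/ al j Z = -1, al j Z = 0 | al j Z = 1].
  have [->|/(root_Z htheta ha hPi hZ hbe hi0)//] := rootal j.
  by constructor 2; rewrite zero_lfunE.
have alX j : `|al j X : R| < pi / 2.
  have pi0 : 0 < pi / 2 :> R by rewrite divr_gt0 // pi_gt0.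
  have [->|ral] := rootal j; first by rewrite zero_lfunE normr0.
  exact: (Omega_bound htheta ha hPi hZ hbe hi0 (reflection_root hiota hG htheta ha)
    (ltW pi0) XO ral).
have gramV j : (\row_j (gram theta e 0 j)^-1) 0 j =
    realC (cartan_form theta (e j) (e j))^-1.
  by rewrite !mxE /realC fmorphV.
have normV0 j : 0 < (cartan_form theta (e j) (e j))^-1.
  by rewrite invr_gt0 (norm_e htheta e0).
have zE j : z 0 j ^+ 2 = realC (1 - 2 * (al j Z : R) ^+ 2).
  rewrite mxE /ZH -(cis_pihalf_sqr (alZ j)).
  by rewrite linearZ.
(* A basis vector occurring in a vector of the highest root space has the highest root as its
   weight, and that root is 1 on Z. *)
have [j1 j1Z] : exists j, al j Z = 1.
  have [[_ [v rv v0]] _] := hbe.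
  have [j vj] : exists j, wcoord theta e v j != 0.
    apply/not_existsP => wcoord_v0; case/eqP: v0; rewrite (wcoordE eE v) big1 // => j _.
    have /negP := wcoord_v0 j; rewrite negbK => /eqP ->; exact: scale0r.
  exists j; rewrite (wcoord_root_space htheta ha eroot rv vj).
  exact: (highest_root_Z hPi hZ hi0).
apply: (@indefinite_not_psd R d (ht al Pi) A B Ak Am (U1 *m U2) z w
  (\row_j (gram theta e 0 j)^-1) j1 Areal Breal BA) => //.
- exact: (gram_dual_invariant htheta hiota e0 eorth eE kA AkT).
- exact: (gram_dual_invariant htheta hiota e0 eorth eE mA AmT).
- by move=> j l /(commute_weights Pcomm) jl; rewrite /ht jl.
- move=> j l /(commute_weights (fun H => commute_invmx Pu (Pcomm H))) jl.
  by rewrite /ht jl.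
- exact: unitriM.
- by move=> j; rewrite gramV zE /realC -rmorphM; exact: realC_real.
(* At [j1] the square is 1 - 2 = -1. *)
- rewrite gramV zE j1Z /realC -rmorphM (ltcR _ 0) expr1n mulr1.
  by rewrite pmulr_llt0 //; lra.
- move=> j; rewrite gramV [w _ _]mxE; exact: cis_sqr_real_gt0.
Qed.
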